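(* Let $\phi:\Sigma^n\to I\times_f M^n$ be an isometric immersion of a gradient Einstein-type structure $(\Sigma^n,g,h,u,\mu,\lambda)$ with potential function $h=\pi_I\circ\phi$, with $\mu\in\mathbb{R}$ a constant, $\mu>0$, and $f$ a convex function. If $\lambda>0$ and the sectional curvature $k_M$ of $M^n$ satisfies $k_M\le f'^2$, then $\phi$ cannot be minimal.
   Context: A gradient Einstein-type structure $(\Sigma^n,g,h,u,\mu,\lambda)$ consists of a connected, complete (possibly compact) Riemannian manifold $(\Sigma^n,g)$, a real number $\alpha>0$, a smooth map $u:(\Sigma^n,g)\to(N^p,g')$ into a Riemannian manifold, with tension field $\tau_g u=\mathrm{trace}\,\nabla(du)$, and smooth functions $h,\mu,\lambda$ on $\Sigma$ such that $Ric_g-\alpha u^*g'+\mathrm{Hess}\,h-\mu\,dh\otimes dh=\lambda g$ and $\tau_g u=du(\nabla h)$. $I\times_f M^n$ is $I\times M^n$ with metric $\pi_I^*(dt^2)+f^2(\pi_I)\pi_M^*(g_M)$, where $I\subset\mathbb{R}$ is an open interval, $f:I\to(0,\infty)$ is smooth, and $M^n$ is a connected oriented Riemannian manifold. The condition $k_M\le f'^2$ means that every sectional curvature of $M$ is at most $f'(t)^2$ for all $t\in I$. Minimal means that the mean curvature $H$ (with $nH=\mathrm{tr}\,A$, $A$ the shape operator) vanishes identically. *)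

(* Defs.v *)
From HB Require Import structures.
From mathcomp Require Import all_boot all_order all_algebra.
From mathcomp Require Import all_classical all_reals all_analysis.

Set Implicit Arguments.
Unset Strict Implicit.
Unset Printing Implicit Defensive.

Import Order.TTheory GRing.Theory Num.Theory.
Import numFieldNormedType.Exports.

Local Open Scope ring_scope.
Local Open Scope classical_set_scope.

(** * Tensor calculus in an open subset of R^n

   A metric is a matrix-valued function [g], [g x i j] being the component
   [g_ij] at [x].  Derivatives are total functions, so the formulas below are
   meaningful only at interior points of a set on which the data are smooth. *)

Section Local.
Variable R : realType.

Definition partial n (i : 'I_n) (F : 'rV[R]_n -> R) : 'rV[R]_n -> R :=
  fun x => 'D_(delta_mx 0 i) F x.

Fixpoint Ck n (k : nat) (U : set 'rV[R]_n) (F : 'rV[R]_n -> R) : Prop :=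
  (forall x, U x -> {for x, continuous F}) /\
  if k is k'.+1 then
    forall i, (forall x, U x -> derivable F x (delta_mx 0 i)) /\
              Ck k' U (partial i F)
  else True.

(* To be used on open sets [U] only. *)
Definition smooth_on n (U : set 'rV[R]_n) (F : 'rV[R]_n -> R) : Prop :=
  forall k, Ck k U F.

Definition comp n m (F : 'rV[R]_n -> 'rV[R]_m) (a : 'I_m) : 'rV[R]_n -> R :=
  fun x => F x 0 a.

(* Row [i] of [dmap F x] is the image of the [i]-th coordinate vector under
   the differential of [F] at [x]. *)
Definition dmap n m (F : 'rV[R]_n -> 'rV[R]_m) (x : 'rV[R]_n) : 'M[R]_(n, m) :=
  \matrix_(i, a) partial i (comp F a) x.

Definition pullback n m (F : 'rV[R]_n -> 'rV[R]_m) (g : 'rV[R]_m -> 'M[R]_m)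
    (x : 'rV[R]_n) : 'M[R]_n :=
  dmap F x *m g (F x) *m (dmap F x)^T.

Definition inner n (G : 'M[R]_n) (v w : 'rV[R]_n) : R := (v *m G *m w^T) 0 0.

Definition christoffel n (g : 'rV[R]_n -> 'M[R]_n) (k i j : 'I_n)
    (x : 'rV[R]_n) : R :=
  2^-1 * \sum_l invmx (g x) k l *
    (partial i (fun y => g y j l) x + partial j (fun y => g y i l) x
     - partial l (fun y => g y i j) x).

(* Component [l] of [R(d_i, d_j) d_k], with the convention
   [R(X, Y) Z = D_X D_Y Z - D_Y D_X Z - D_[X,Y] Z]. *)
Definition riemann n (g : 'rV[R]_n -> 'M[R]_n) (l i j k : 'I_n)
    (x : 'rV[R]_n) : R :=
  partial i (christoffel g l j k) x - partial j (christoffel g l i k) x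
  + \sum_m (christoffel g l i m x * christoffel g m j k x
            - christoffel g l j m x * christoffel g m i k x).

(* [Ric(Y, Z)] is the trace of [X |-> R(X, Y) Z]. *)
Definition ricci n (g : 'rV[R]_n -> 'M[R]_n) (j k : 'I_n) (x : 'rV[R]_n) : R :=
  \sum_i riemann g i i j k x.

Definition curv n (g : 'rV[R]_n -> 'M[R]_n) (x u v w : 'rV[R]_n) : 'rV[R]_n :=
  \row_l \sum_i \sum_j \sum_k riemann g l i j k x * u 0 i * v 0 j * w 0 k.

Definition sectional n (g : 'rV[R]_n -> 'M[R]_n) (x v w : 'rV[R]_n) : R :=
  inner (g x) (curv g x v w w) v /
  (inner (g x) v v * inner (g x) w w - inner (g x) v w ^+ 2).

Definition hess n (g : 'rV[R]_n -> 'M[R]_n) (h : 'rV[R]_n -> R) (i j : 'I_n)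
    (x : 'rV[R]_n) : R :=
  partial i (partial j h) x - \sum_k christoffel g k i j x * partial k h x.

Definition grad n (g : 'rV[R]_n -> 'M[R]_n) (h : 'rV[R]_n -> R)
    (x : 'rV[R]_n) : 'rV[R]_n :=
  \row_i \sum_j invmx (g x) i j * partial j h x.

(* The vector [D'_{d_i} (dF d_j) - dF (D_{d_i} d_j)], with [D], [D'] the
   Levi-Civita connections of [g] and [g'].  It is [(nabla dF)(d_i, d_j)] for
   any map [F], and the second fundamental form when [F] is an isometric
   immersion (Gauss formula). *)
Definition nabla_d n m (g : 'rV[R]_n -> 'M[R]_n) (g' : 'rV[R]_m -> 'M[R]_m)
    (F : 'rV[R]_n -> 'rV[R]_m) (i j : 'I_n) (x : 'rV[R]_n) : 'rV[R]_m :=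
  \row_a (partial i (partial j (comp F a)) x
          - \sum_k christoffel g k i j x * partial k (comp F a) x
          + \sum_b \sum_c christoffel g' a b c (F x) *
              partial i (comp F b) x * partial j (comp F c) x).

Definition tension n m (g : 'rV[R]_n -> 'M[R]_n) (g' : 'rV[R]_m -> 'M[R]_m)
    (F : 'rV[R]_n -> 'rV[R]_m) (x : 'rV[R]_n) : 'rV[R]_m :=
  \sum_i \sum_j invmx (g x) i j *: nabla_d g g' F i j x.

Definition unit_normal n m (g' : 'rV[R]_m -> 'M[R]_m)
    (F : 'rV[R]_n -> 'rV[R]_m) (x : 'rV[R]_n) (nu : 'rV[R]_m) : Prop :=
  inner (g' (F x)) nu nu = 1 /\
  forall v : 'rV[R]_n, inner (g' (F x)) (v *m dmap F x) nu = 0.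

(* Shape operator in the normal direction [nu], acting on row vectors: it is
   determined by [<A d_i, d_j> = <II(d_i, d_j), nu>]. *)
Definition shape_operator n m (g : 'rV[R]_n -> 'M[R]_n)
    (g' : 'rV[R]_m -> 'M[R]_m) (F : 'rV[R]_n -> 'rV[R]_m) (x : 'rV[R]_n)
    (nu : 'rV[R]_m) : 'M[R]_n :=
  (\matrix_(i, j) inner (g' (F x)) (nabla_d g g' F i j x) nu) *m invmx (g x).

Definition mean_curvature n m (g : 'rV[R]_n -> 'M[R]_n)
    (g' : 'rV[R]_m -> 'M[R]_m) (F : 'rV[R]_n -> 'rV[R]_m) (x : 'rV[R]_n)
    (nu : 'rV[R]_m) : R :=
  \tr (shape_operator g g' F x nu) / n%:R.

End Local.

(** * Riemannian manifolds

   [geometry R n] is the raw data of an n-dimensional Riemannian manifold: an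
   atlas (not assumed maximal) and the components of the metric in each chart.
   The conditions on these data are in [riemannian_manifold].  [coord c] is
   relevant on [dom c] only, [param c] and [metric c] on [coord c @` dom c]
   only. *)

Record geometry (R : realType) (n : nat) := Geometry {
  point_of :> topologicalType;
  chart : Type;
  dom : chart -> set point_of;
  coord : chart -> point_of -> 'rV[R]_n;
  param : chart -> 'rV[R]_n -> point_of;
  metric : chart -> 'rV[R]_n -> 'M[R]_n
}.

Section Manifolds.
Variable R : realType.

Definition local_map n m (X : geometry R n) (Y : geometry R m) (F : X -> Y)
    (c : chart X) (d : chart Y) : 'rV[R]_n -> 'rV[R]_m :=
  fun x => coord d (F (param c x)).

Definition local_fun n (X : geometry R n) (h : X -> R) (c : chart X) :
    'rV[R]_n -> R :=
  fun x => h (param c x).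

Definition smooth_fun n (X : geometry R n) (h : X -> R) : Prop :=
  forall c, smooth_on (coord c @` dom c) (local_fun h c).

Definition smooth_map n m (X : geometry R n) (Y : geometry R m) (F : X -> Y) :
    Prop :=
  continuous F /\
  forall c d a, smooth_on (coord c @` (dom c `&` F @^-1` dom d))
                          (comp (local_map F c d) a).

Definition transition n (X : geometry R n) (c d : chart X) :
    'rV[R]_n -> 'rV[R]_n :=
  local_map (fun q : X => q) c d.

Record smooth_manifold n (X : geometry R n) : Prop := {
  mfd_hausdorff : hausdorff_space X;
  mfd_second_countable : @second_countable X;
  mfd_cover : forall q : X, exists c, dom c q;
  mfd_dom_open : forall c : chart X, open (dom c);
  mfd_image_open : forall c : chart X, open (coord c @` dom c);
  mfd_coordK : forall (c : chart X) q, dom c q -> param c (coord c q) = q;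
  mfd_coord_continuous : forall (c : chart X) q, dom c q ->
    {for q, continuous (coord c)};
  mfd_param_continuous : forall (c : chart X) x, (coord c @` dom c) x ->
    {for x, continuous (param c)};
  mfd_transition_smooth : forall (c d : chart X) a,
    smooth_on (coord c @` (dom c `&` dom d)) (comp (transition c d) a)
}.

Record riemannian_manifold n (X : geometry R n) : Prop := {
  riem_manifold : smooth_manifold X;
  riem_smooth : forall (c : chart X) i j,
    smooth_on (coord c @` dom c) (fun x => metric c x i j);
  riem_sym : forall (c : chart X) x, (coord c @` dom c) x ->
    (metric c x)^T = metric c x;
  riem_posdef : forall (c : chart X) x, (coord c @` dom c) x ->
    forall v, v != 0 -> 0 < inner (metric c x) v v;
  riem_change : forall (c d : chart X) x,
    (coord c @` (dom c `&` dom d)) x ->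
    metric c x = pullback (transition c d) (metric d) x
}.

Definition connected_manifold n (X : geometry R n) : Prop :=
  [set: X] !=set0 /\ connected [set: X].

(* The orientation is the one carried by the given atlas. *)
Definition oriented n (X : geometry R n) : Prop :=
  forall (c d : chart X) x, (coord c @` (dom c `&` dom d)) x ->
    0 < \det (dmap (transition c d) x).

Definition curve_coord n (X : geometry R n) (gamma : R -> X) (c : chart X)
    (k : 'I_n) : R -> R :=
  fun t => coord c (gamma t) 0 k.

Definition geodesic n (X : geometry R n) (gamma : R -> X) : Prop :=
  continuous gamma /\
  forall c t, dom c (gamma t) -> forall k,
    [/\ derivable (curve_coord gamma c k) t 1,
        derivable (derive1 (curve_coord gamma c k)) t 1 &
        derive1n 2 (curve_coord gamma c k) t
        + \sum_i \sum_j christoffel (metric c) k i j (coord c (gamma t)) *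
            derive1 (curve_coord gamma c i) t * derive1 (curve_coord gamma c j) t = 0].

(* Geodesic completeness: every initial condition is that of a geodesic
   defined on the whole real line. *)
Definition complete_manifold n (X : geometry R n) : Prop :=
  forall (c : chart X) q (v : 'rV[R]_n), dom c q ->
    exists gamma : R -> X,
      [/\ geodesic gamma, gamma 0 = q &
          forall k, derive1 (curve_coord gamma c k) 0 = v 0 k].

Definition sectional_le n (X : geometry R n) (K : R) : Prop :=
  forall (c : chart X) q, dom c q ->
  forall v w : 'rV[R]_n, row_free (col_mx v w) ->
    sectional (metric c) (coord c q) v w <= K.

Record isometric_immersion n m (X : geometry R n) (Y : geometry R m)
    (phi : X -> Y) : Prop := {
  iso_smooth : smooth_map phi;
  iso_immersion : forall c d q, dom c q -> dom d (phi q) ->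
    row_free (dmap (local_map phi c d) (coord c q));
  iso_metric : forall c d q, dom c q -> dom d (phi q) ->
    pullback (local_map phi c d) (metric d) (coord c q) =
    metric c (coord c q)
}.

(* For hypersurfaces.  There are two unit normals at each point and they give
   opposite mean curvatures, so requiring vanishing for both of them is the
   vanishing of [H] and does not involve a choice of a global normal field. *)
Definition minimal n (X : geometry R n) (Y : geometry R (1 + n))
    (phi : X -> Y) : Prop :=
  forall c d q, dom c q -> dom d (phi q) ->
  forall nu, unit_normal (metric d) (local_map phi c d) (coord c q) nu ->
    mean_curvature (metric c) (metric d) (local_map phi c d) (coord c q) nu = 0.

Record gradient_einstein_type n p (X : geometry R n) (N : geometry R p)
    (alpha : R) (h : X -> R) (u : X -> N) (mu lambda : X -> R) : Prop := {
  get_riemannian : riemannian_manifold X;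
  get_connected : connected_manifold X;
  get_complete : complete_manifold X;
  get_target : riemannian_manifold N;
  get_alpha : 0 < alpha;
  get_u_smooth : smooth_map u;
  get_h_smooth : smooth_fun h;
  get_mu_smooth : smooth_fun mu;
  get_lambda_smooth : smooth_fun lambda;
  get_einstein : forall c d q, dom c q -> dom d (u q) -> forall i j,
    let x := coord c q in
    let g := metric c in
    let hc := local_fun h c in
    ricci g i j x - alpha * pullback (local_map u c d) (metric d) x i j
    + hess g hc i j x - mu q * (partial i hc x * partial j hc x) =
    lambda q * g x i j;
  get_tension : forall c d q, dom c q -> dom d (u q) ->
    let x := coord c q in
    let g := metric c in
    tension g (metric d) (local_map u c d) x =
    grad g (local_fun h c) x *m dmap (local_map u c d) x
}.

(** * Warped products *)

Record open_interval := OpenInterval {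
  oi_set :> set R;
  oi_open : open oi_set;
  oi_interval : is_interval oi_set;
  oi_nonempty : oi_set !=set0
}.

(* A left inverse of the inclusion of [I], with an arbitrary value outside. *)
Definition to_interval (I : open_interval) (t : R) : I :=
  match pselect (oi_set I t) with
  | left It => SigSub (mem_set It)
  | right _ => SigSub (mem_set (projT2 (cid (oi_nonempty I))))
  end.

Definition smooth_on_interval (I : open_interval) (f : R -> R) : Prop :=
  forall k t, oi_set I t -> derivable (derive1n k f) t 1.

(* Coordinates are [(t, x)] with [t] the coordinate on the interval and [x]
   the coordinates of a chart of [M]; the metric is [dt^2 + f(t)^2 g_M]. *)
Definition warped_product n (I : open_interval) (f : R -> R)
    (M : geometry R n) : geometry R (1 + n) :=
  @Geometry R (1 + n) (I * M)%type (chart M)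
    (fun d => [set z | dom d z.2])
    (fun d z => row_mx (const_mx (set_val z.1)) (coord d z.2))
    (fun d y => (to_interval I (y 0 0), param d (rsubmx y)))
    (fun d y => block_mx 1%:M 0 0 (f (y 0 0) ^+ 2 *: metric d (rsubmx y))).

Definition proj_interval n (I : open_interval) (f : R -> R) (M : geometry R n)
    (z : warped_product I f M) : R := set_val z.1.

End Manifolds.

(* Main.v *)
Require Import Defs.
From HB Require Import structures.
From mathcomp Require Import all_boot all_order all_algebra.
From mathcomp Require Import all_classical all_reals all_analysis.
From mathcomp Require Import ring lra.
Import Order.TTheory GRing.Theory Num.Theory.
Import numFieldNormedType.Exports.
Local Open Scope ring_scope.
Local Open Scope classical_set_scope.
Import Defs.

(** Let [h] be the height function.  The curvature of the warped product in the
    directions [(a, x)], [(b, v)] is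
    [- f f'' |w|^2 + f^2 (<R(x, v) v, x> - f'^2 (|x|^2 |v|^2 - <x, v>^2))] with
    [w = a v - b x], hence nonpositive when [f'' >= 0] and [k_M <= f'^2].  For a
    minimal immersion the Gauss equation then gives [Ric <= 0] on [Sigma], and
    the Einstein-type equation yields
    [Hess h >= lambda g + mu dh (x) dh].  Along a complete geodesic [gamma] with
    nonzero velocity at 0, the function [y = (h o gamma)'] satisfies
    [y' >= mu y^2] on the whole line and [y'(0) > 0], which is impossible because
    a solution of this inequality that is nonzero somewhere blows up in finite
    time, forwards or backwards. *)

Set Implicit Arguments.
Unset Strict Implicit.
Unset Printing Implicit Defensive.

(** * Differentiability and symmetry of second derivatives *)

(** Over an orthonormal frame [e_a] the Gauss equation makes [Ric(v, v)] a sum of three terms: the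
    ambient curvature of [e_a, v], the pairing of [II(v, v)] with [II(e_a, e_a)], and
    [- |II(e_a, v)|^2]. The middle terms add up to the pairing of [II(v, v)] with the tension field
    of the immersion, which is where minimality enters. In the Einstein-type equation [alpha u^*g']
    is nonnegative, so [- Ric] and [alpha u^*g'] both push [Hess h] up. Positivity of [lambda] acts
    twice: it gives [y' >= mu y^2] at every time and the strict inequality at time 0.

    The data are component functions in charts, so the Gauss equation is proved as an identity of
    matrices: connections are matrices acting on row vectors from the right, and [II] is
    vector-valued, which avoids choosing a normal field. Uniqueness of the torsion-free metric
    connection does the work of explicit computations: it shows that [II] is normal, and it
    identifies the connection of the warped product without inverting the metric. *)

Section Calculus.
Context {R : realType}.

Lemma is_derive_line n (F : 'rV[R]_n -> R) (p e : 'rV[R]_n) (r : R) :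
  derivable F (p + r *: e) e ->
  is_derive r 1 (fun s : R => F (p + s *: e)) ('D_e F (p + r *: e)).
Proof.
have E (h : R) : h^-1 *: (((fun s : R => F (p + s *: e)) \o shift r) (h *: 1)
      - F (p + r *: e)) =
    h^-1 *: ((F \o shift (p + r *: e)) (h *: e) - F (p + r *: e)).
  by rewrite /= [h *: 1]mulr1 scalerDl addrCA addrA.
move=> dF; split; rewrite /derivable /derive.
  by rewrite (funext E); exact: dF.
by congr (lim (_ @ 0^')); exact: funext E.
Qed.

Lemma mvt_line n (F : 'rV[R]_n -> R) (p e : 'rV[R]_n) (s : R) :
  (forall r : R, `|r| <= `|s| -> derivable F (p + r *: e) e) ->
  exists2 c, `|c| <= `|s| & F (p + s *: e) - F p = s * 'D_e F (p + c *: e).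
Proof.
move=> dF.
have dG (r : R) : `|r| <= `|s| ->
    is_derive r 1 (fun r : R => F (p + r *: e)) ('D_e F (p + r *: e)).
  by move=> /dF/is_derive_line.
have cG (A : set R) : (forall r : R, A r -> `|r| <= `|s|) ->
    {within A, continuous (fun r : R => F (p + r *: e))}.
  move=> Abd; apply: continuous_in_subspaceT => r; rewrite inE => /Abd/dG[d _].
  exact/differentiable_continuous/derivable1_diffP.
have [s0|s0] := leP 0 s.
- have [||c cs E] := @MVT_segment R (fun r : R => F (p + r *: e))
      (fun r => 'D_e F (p + r *: e)) 0 s s0.
  + move=> r; rewrite in_itv/= => /andP[r0 rs]; apply: dG.
    by rewrite !ger0_norm// ltW.
  + apply: cG => r /=; rewrite in_itv/= => /andP[r0 rs].
    by rewrite !ger0_norm.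
  exists c; first by move: cs; rewrite in_itv/= => /andP[c0 cs]; rewrite !ger0_norm.
  by move: E; rewrite scale0r addr0 subr0 mulrC.
- have [||c cs E] := @MVT_segment R (fun r : R => F (p + r *: e))
      (fun r => 'D_e F (p + r *: e)) s 0 (ltW s0).
  + move=> r; rewrite in_itv/= => /andP[r0 rs]; apply: dG.
    by rewrite !ltr0_norm// lerN2 ltW.
  + apply: cG => r /=; rewrite in_itv/= => /andP[r0 rs].
    by rewrite (ltr0_norm s0) ler0_norm// lerN2.
  exists c.
    move: cs; rewrite in_itv/= => /andP[c0 cs].
    by rewrite (ltr0_norm s0) ler0_norm// lerN2.
  move: E; rewrite scale0r addr0 sub0r => E.
  by apply: oppr_inj; rewrite opprB E mulrN mulrC.
Qed.

(** [differentiable] refers to the chosen differential ['d F x]; uniqueness of the first-order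
    expansion identifies it with the candidate [df]. *)
Lemma diff_of_eqo (V W : normedModType R) (F : V -> W) (df : {linear V -> W}) x :
  continuous df -> F \o shift x = cst (F x) + df +o_ 0 id ->
  differentiable F x.
Proof.
move=> dfc E; have d := diff_unique dfc E.
by apply/diff_locallyP; rewrite d.
Qed.

Lemma entry_le_norm n (v : 'rV[R]_n) i : `|v 0 i| <= `|v|.
Proof.
rewrite [leRHS]/Num.Def.normr/= mx_normrE.
exact: (le_bigmax _ (fun ij => `|v ij.1 ij.2|) (0, i)).
Qed.

Lemma norm_le_entries n (v w : 'rV[R]_n) :
  (forall i, `|v 0 i| <= `|w 0 i|) -> `|v| <= `|w|.
Proof.
move=> H; rewrite [leLHS]/Num.Def.normr/= mx_normrE.
apply: bigmax_le => [|[i j] _ /=]; first exact: normr_ge0.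
by rewrite ord1; apply: le_trans (H j) (entry_le_norm _ _).
Qed.

(** Corners of the path from [0] to [v] that follows one coordinate axis at a time. *)
Definition trunc_row n (k : nat) (v : 'rV[R]_n) : 'rV[R]_n :=
  \row_i (if (i < k)%N then v 0 i else 0).

Lemma trunc_rowS n (k : 'I_n) (v : 'rV[R]_n) :
  trunc_row k.+1 v = trunc_row k v + v 0 k *: delta_mx 0 k.
Proof.
apply/rowP => i; rewrite !mxE eqxx /= ltnS leq_eqVlt.
have [->|ik] := eqVneq i k; first by rewrite eqxx ltnn mulr1 add0r.
by rewrite -val_eqE in ik; rewrite (negPf ik) mulr0 addr0.
Qed.

(* The increment is telescoped along the coordinate directions and each step
   is handled by the mean value theorem. *)
Lemma C1_differentiable n (F : 'rV[R]_n -> R) (x : 'rV[R]_n) :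
  (\forall y \near x, forall i, derivable F y (delta_mx 0 i)) ->
  (forall i, {for x, continuous (partial i F)}) -> differentiable F x.
Proof.
move=> dF cF.
pose d (v : 'rV[R]_n) : R := \sum_i v 0 i * partial i F x.
have lind : linear d.
  move=> a v w; rewrite /d scaler_sumr -big_split /=.
  by apply: eq_bigr => i _; rewrite !mxE mulrDl -mulrA.
pose dM := GRing.isLinear.Build _ _ _ _ _ lind.
pose dL : {linear 'rV[R]_n -> R} := HB.pack d dM.
apply: (@diff_of_eqo _ _ F dL).
  move=> v; rewrite /dL /= /d; apply: differentiable_continuous.
  have -> : (fun v : 'rV[R]_n => \sum_i v 0 i * partial i F x) =
      \sum_i ((fun v : 'rV[R]_n => v 0 i) * cst (partial i F x)).
    by apply/funext => w; rewrite fct_sumE; apply: eq_bigr.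
  by apply: differentiable_sum => i; apply: differentiableM;
    [exact: differentiable_coord|exact: differentiable_cst].
apply/eqaddoP => eps eps0.
(* Each of the [n] steps may cost [eps / n.+1]; the successor keeps the denominator nonzero for
   [n = 0]. *)
have e' : 0 < eps / n.+1%:R by rewrite divr_gt0.
have H : \forall y \near x, forall i,
    derivable F y (delta_mx 0 i) /\
    `|partial i F x - partial i F y| <= eps / n.+1%:R.
  near=> y => i; split; first by move: i; near: y.
  move: i; near: y; apply: filter_forall => i.
  exact: (cvgrPdist_le _ _).1 (cF i) _ e'.
have /nbhs_normP[r r0 Hr] := H.
near=> v; change (`|F (v + x) - (F x + d v)| <= eps * `|v|).
have vr : `|v| < r.
  by near: v; apply: (@nbhs0_lt _ 'rV[R]_n r r0).
(* In the sup norm no point of the path is longer than [v], so the path stays in the ball where the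
   partial derivatives are controlled. *)
have tv (k : 'I_n) (c : R) : `|c| <= `|v 0 k| -> `|trunc_row k v + c *: delta_mx 0 k| <= `|v|.
  move=> ck; apply: norm_le_entries => i; rewrite !mxE eqxx /=.
  have [->|ik] := eqVneq i k; first by rewrite ltnn mulr1 add0r.
  by rewrite mulr0 addr0; case: ifP => // _; rewrite normr0.
have step (k : 'I_n) : exists2 c, `|trunc_row k v + c *: delta_mx 0 k| <= `|v| &
    F (x + trunc_row k.+1 v) - F (x + trunc_row k v) =
    v 0 k * partial k F (x + (trunc_row k v + c *: delta_mx 0 k)).
  have [|c ck E] := @mvt_line _ F (x + trunc_row k v) (delta_mx 0 k) (v 0 k).
    move=> c ck; apply: (Hr _ _ _).1; rewrite /= -addrA opprD addNKr normrN.
    exact: le_lt_trans (tv _ _ ck) vr.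
  by exists c; [exact: tv|rewrite trunc_rowS addrA E addrA].
have E : F (v + x) - F x =
    \sum_(k < n) (F (x + trunc_row k.+1 v) - F (x + trunc_row k v)).
  rewrite -(big_mkord xpredT (fun k => F (x + trunc_row k.+1 v) - F (x + trunc_row k v))).
  have -> : v + x = x + trunc_row n v.
    by rewrite addrC; congr (_ + _); apply/rowP => i; rewrite mxE ltn_ord.
  have E0 : x = x + trunc_row 0 v.
    by rewrite -[LHS]addr0; congr (_ + _); apply/rowP => i; rewrite !mxE.
  by rewrite telescope_sumr // -E0.

have -> : F (v + x) - (F x + d v) = \sum_(k < n)
  (F (x + trunc_row k.+1 v) - F (x + trunc_row k v) - v 0 k * partial k F x).
  by rewrite opprD addrA E -sumrB.
apply: le_trans (ler_norm_sum _ _ _) _.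
apply: (@le_trans _ _ (\sum_(k < n) (`|v| * (eps / n.+1%:R)))).
  apply: ler_sum => k _; have [c cv ->] := step k.
  rewrite -mulrBr normrM ler_pM// ?entry_le_norm// distrC.
  apply: (Hr _ _ _).2; rewrite /= opprD addNKr normrN.
  exact: le_lt_trans cv vr.
rewrite sumr_const card_ord.
have aux (a e : R) : 0 <= a -> 0 < e -> a * (e / n.+1%:R) *+ n <= e * a.
  move=> a0 e0; rewrite -mulr_natr -mulrA mulrC ler_wpM2r//.
  rewrite -mulrA ler_piMr ?(ltW e0)//.
  by rewrite ler_pdivrMl ?mulr1 ?ler_nat// ltr0n.
exact: aux.
Unshelve. all: by end_near.
Qed.

End Calculus.

Section Schwarz.
Context {R : realType}.

Lemma is_derive_translate n (F : 'rV[R]_n -> R) (c x v : 'rV[R]_n) :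
  derivable F (x + c) v ->
  is_derive x v (fun y => F (y + c)) ('D_v F (x + c)).
Proof.
have E (h : R) : h^-1 *: (((fun y => F (y + c)) \o shift x) (h *: v) - F (x + c)) =
    h^-1 *: ((F \o shift (x + c)) (h *: v) - F (x + c)).
  by rewrite /= addrA.
move=> dF; split; rewrite /derivable /derive.
  by rewrite (funext E); exact: dF.
by congr (lim (_ @ 0^')); exact: funext E.
Qed.

(** The mean value theorem twice: along [a] for [F (y + s *: b) - F y], then along [b] for
    ['D_a F]. *)
Lemma second_difference n (F : 'rV[R]_n -> R) (x a b : 'rV[R]_n) (s : R) :
  (forall r t : R, `|r| <= `|s| -> `|t| <= `|s| ->
     derivable F (x + r *: a + t *: b) a /\
     derivable ('D_a F) (x + r *: a + t *: b) b) ->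
  exists r t : R, [/\ `|r| <= `|s|, `|t| <= `|s| &
    F (x + s *: a + s *: b) - F (x + s *: a) - (F (x + s *: b) - F x) =
    s * (s * 'D_b ('D_a F) (x + r *: a + t *: b))].
Proof.
move=> H.
have dphi (r : R) : `|r| <= `|s| ->
    is_derive (x + r *: a) a (fun y => F (y + s *: b) - F y)
      ('D_a F (x + r *: a + s *: b) - 'D_a F (x + r *: a)).
  move=> rs; apply: (@is_deriveB _ _ _ (fun y => F (y + s *: b)) F).
    by apply: is_derive_translate; apply: (H _ _ _ _).1.
  apply: derivableP; have := (H r 0 rs _).1; rewrite scale0r addr0; apply.
  by rewrite normr0.
have [|r rs E] := @mvt_line R n (fun y => F (y + s *: b) - F y) x a s.
  by move=> r /dphi[].
rewrite (@derive_val _ _ _ _ _ _ _ (dphi r rs)) in E.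
have [|t ts E2] := @mvt_line R n ('D_a F) (x + r *: a) b s.
  by move=> t ts; apply: (H _ _ _ _).2.
by exists r, t; split => //; rewrite E E2.
Qed.

(** The second difference is symmetric in [a] and [b], so the two mixed derivatives take a common
    value at two points close to [x]; their continuity carries the equality to [x]. *)
Lemma schwarz n (F : 'rV[R]_n -> R) (x a b : 'rV[R]_n) :
  (\forall y \near x, [/\ derivable F y a, derivable F y b,
     derivable ('D_a F) y b & derivable ('D_b F) y a]) ->
  {for x, continuous ('D_b ('D_a F))} ->
  {for x, continuous ('D_a ('D_b F))} ->
  'D_b ('D_a F) x = 'D_a ('D_b F) x.
Proof.
move=> dF cab cba; apply/eqP; rewrite -subr_eq0 -normr_le0.
apply/ler_addgt0Pl => e e0; rewrite addr0.
have e2 : 0 < e / 2 by rewrite divr_gt0.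
move/cvgrPdist_le : cab => /(_ _ e2) cab.
move/cvgrPdist_le : cba => /(_ _ e2) cba.
have Hn : \forall y \near x,
    [/\ derivable F y a, derivable F y b,
      derivable ('D_a F) y b & derivable ('D_b F) y a] /\
    (`|'D_b ('D_a F) x - 'D_b ('D_a F) y| <= e / 2 /\
    `|'D_a ('D_b F) x - 'D_a ('D_b F) y| <= e / 2).
  exact: filterI dF (filterI cab cba).
have /nbhs_normP[d d0 Hd] := Hn.
(* With this step [x + r a + t b] stays at distance less than [d] from [x]; the summand 1 makes the
   bound strict and the denominator positive. *)
pose s := d / (`|a| + `|b| + 1).
have k0 : 0 < `|a| + `|b| + 1 by rewrite ltr_wpDl ?addr_ge0.
have s0 : 0 < s by rewrite divr_gt0.
have small (r t : R) : `|r| <= `|s| -> `|t| <= `|s| ->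
    ball_ Num.Def.normr x d (x + r *: a + t *: b).
  rewrite (gtr0_norm s0) => rs ts.
  rewrite /= -addrA opprD addNKr normrN.
  apply: le_lt_trans (ler_normD _ _) _; rewrite !normrZ.
  apply: (@le_lt_trans _ _ (s * `|a| + s * `|b|)).
    by rewrite lerD// ler_wpM2r.
  rewrite -mulrDr /s mulrAC ltr_pdivrMr// ltr_pM2l// ltrDl//.
have [|r [t [rs ts E1]]] := @second_difference n F x a b s.
  by move=> r t rs ts; have [[]] := Hd _ (small r t rs ts).
have [|r' [t' [rs' ts' E2]]] := @second_difference n F x b a s.
  move=> r' t' rs' ts'.
  have -> : x + r' *: b + t' *: a = x + t' *: a + r' *: b by exact: addrAC.
  by have [[_ H1 _ H2] _] := Hd _ (small t' r' ts' rs'); split.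
have E : 'D_b ('D_a F) (x + r *: a + t *: b) =
    'D_a ('D_b F) (x + t' *: a + r' *: b).
  apply: (@mulfI _ s); first by rewrite gt_eqF.
  apply: (@mulfI _ s); first by rewrite gt_eqF.
  have A1 : x + s *: b + s *: a = x + s *: a + s *: b by exact: addrAC.
  have A2 : x + r' *: b + t' *: a = x + t' *: a + r' *: b by exact: addrAC.
  move: E2; rewrite A1 A2 => E2.
  apply: etrans (esym E1) _; apply: etrans _ E2.
  have swap (p q u w : R) : p - q - (u - w) = p - u - (q - w) by ring.
  exact: swap.
have [_ [H1 _]] := Hd _ (small _ _ rs ts).
have [_ [_ H2]] := Hd _ (small _ _ ts' rs').
rewrite (splitr e).
rewrite E in H1.
have tri (p q w : R) : `|p - w| <= e / 2 -> `|q - w| <= e / 2 ->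
    `|p - q| <= e / 2 + e / 2.
  move=> pw qw; have -> : p - q = (p - w) - (q - w) by ring.
  by apply: le_trans (ler_normB _ _) _; rewrite lerD.
exact: tri H1 H2.
Qed.

End Schwarz.

(** * Calculus of matrix-valued functions *)

Section MatrixCalculus.
Context {R : realType}.

(** Entrywise notions, so that the product rules reduce to scalar ones; [mDE] recovers the
    derivative of the matrix-valued map. *)
Definition mdiff (V : normedModType R) a b (A : V -> 'M[R]_(a, b)) (x : V) :=
  forall i j, differentiable (fun y => A y i j) x.

Definition mD (V : normedModType R) a b (v : V) (A : V -> 'M[R]_(a, b)) (x : V)
    : 'M[R]_(a, b) := \matrix_(i, j) 'D_v (fun y => A y i j) x.

Lemma mDij (V : normedModType R) a b (v : V) (A : V -> 'M[R]_(a, b)) x i j :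
  mD v A x i j = 'D_v (fun y => A y i j) x.
Proof. by rewrite mxE. Qed.

Section Rules.
Context {V : normedModType R}.
Implicit Types (f g : V -> R) (x v : V).

Lemma differentiable_fsum (I : finType) (f : I -> V -> R) x :
  (forall i, differentiable (f i) x) ->
  differentiable (fun y => \sum_i f i y) x.
Proof.
move=> df; have -> : (fun y => \sum_i f i y) = \sum_i f i.
  by apply/funext => y; rewrite fct_sumE.
by elim/big_ind : _ => // *; exact: differentiableD.
Qed.

Lemma derive_fsum (I : finType) (f : I -> V -> R) x v :
  (forall i, differentiable (f i) x) ->
  'D_v (fun y => \sum_i f i y) x = \sum_i 'D_v (f i) x.
Proof.
move=> df; have -> : (fun y => \sum_i f i y) = \sum_i f i.
  by apply/funext => y; rewrite fct_sumE.
suff [] : is_derive x v (\sum_i f i) (\sum_i 'D_v (f i) x) by [].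
elim/big_ind2 : _ => [|? ? ? ? ? ?|i _]; first exact: is_derive_cst.
- exact: is_deriveD.
- exact/derivableP/diff_derivable.
Qed.

Lemma differentiable_fprod (I : finType) (f : I -> V -> R) x :
  (forall i, differentiable (f i) x) ->
  differentiable (fun y => \prod_i f i y) x.
Proof.
move=> df; have -> : (fun y => \prod_i f i y) = \prod_i f i.
  by apply/funext => y; rewrite fct_prodE.
by elim/big_ind : _ => // *; exact: differentiableM.
Qed.

Lemma derive_fM f g x v : differentiable f x -> differentiable g x ->
  'D_v (fun y => f y * g y) x = 'D_v f x * g x + f x * 'D_v g x.
Proof.
move=> df dg; rewrite (@deriveM _ _ f g); [|exact: diff_derivable..].
by rewrite addrC; congr (_ + _); rewrite mulrC.
Qed.

Lemma derive_fD f g x v : differentiable f x -> differentiable g x ->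
  'D_v (fun y => f y + g y) x = 'D_v f x + 'D_v g x.
Proof. by move=> df dg; rewrite (@deriveD _ _ _ f g)//; exact: diff_derivable. Qed.

Lemma derive_fN f x v : differentiable f x ->
  'D_v (fun y => - f y) x = - 'D_v f x.
Proof. by move=> df; rewrite (@deriveN _ _ _ f)//; exact: diff_derivable. Qed.

Lemma near_differentiable f g x :
  (\near x, f x = g x) -> differentiable f x -> differentiable g x.
Proof.
move=> fg df; have fgx := nbhs_singleton fg.
apply: (@diff_of_eqo _ _ _ g ('d f x)); first exact: diff_continuous.
have /eqaddoP H := diff_locally df.
apply/eqaddoP => eps eps0; have := H _ eps0.
have : \forall v \near 0, f (v + x) = g (v + x).
  by move: fg; rewrite (near_shift 0) subr0.
apply: filterS2 => v /= E.
by rewrite /GRing.add /GRing.opp /= -/(shift x v) E fgx.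
Qed.

End Rules.

Section MRules.
Context {V : normedModType R}.
Implicit Types (x v w : V).

Lemma mdiff_cst a b (A : 'M[R]_(a, b)) x : mdiff (fun _ : V => A) x.
Proof. by move=> i j; exact: differentiable_cst. Qed.

Lemma mdiffD a b (A B : V -> 'M[R]_(a, b)) x : mdiff A x -> mdiff B x ->
  mdiff (fun y => A y + B y) x.
Proof.
move=> dA dB i j; under eq_fun do rewrite mxE; exact: differentiableD.
Qed.

Lemma mdiffN a b (A : V -> 'M[R]_(a, b)) x : mdiff A x ->
  mdiff (fun y => - A y) x.
Proof. by move=> dA i j; under eq_fun do rewrite mxE; exact: differentiableN. Qed.

Lemma mdiffB a b (A B : V -> 'M[R]_(a, b)) x : mdiff A x -> mdiff B x ->
  mdiff (fun y => A y - B y) x.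
Proof. by move=> dA dB; apply: mdiffD => //; exact: mdiffN. Qed.

Lemma mdiffM a b c (A : V -> 'M[R]_(a, b)) (B : V -> 'M[R]_(b, c)) x :
  mdiff A x -> mdiff B x -> mdiff (fun y => A y *m B y) x.
Proof.
move=> dA dB i j; under eq_fun do rewrite mxE.
by apply: differentiable_fsum => k; exact: differentiableM.
Qed.

Lemma mdiff_tr a b (A : V -> 'M[R]_(a, b)) x : mdiff A x ->
  mdiff (fun y => (A y)^T) x.
Proof. by move=> dA i j; under eq_fun do rewrite mxE. Qed.

Lemma mdiffZ a b (f : V -> R) (A : V -> 'M[R]_(a, b)) x :
  differentiable f x -> mdiff A x -> mdiff (fun y => f y *: A y) x.
Proof.
by move=> df dA i j; under eq_fun do rewrite mxE; exact: differentiableM.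
Qed.

Lemma mD_cst a b (A : 'M[R]_(a, b)) x v : mD v (fun _ : V => A) x = 0.
Proof. by apply/matrixP => i j; rewrite !mxE derive_cst. Qed.

Lemma mD_D a b (A B : V -> 'M[R]_(a, b)) x v : mdiff A x -> mdiff B x ->
  mD v (fun y => A y + B y) x = mD v A x + mD v B x.
Proof.
move=> dA dB; apply/matrixP => i j; rewrite !mxE.
by under eq_fun do rewrite mxE; rewrite derive_fD.
Qed.

Lemma mD_N a b (A : V -> 'M[R]_(a, b)) x v : mdiff A x ->
  mD v (fun y => - A y) x = - mD v A x.
Proof.
move=> dA; apply/matrixP => i j; rewrite !mxE.
by under eq_fun do rewrite mxE; rewrite derive_fN.
Qed.

Lemma mD_B a b (A B : V -> 'M[R]_(a, b)) x v : mdiff A x -> mdiff B x ->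
  mD v (fun y => A y - B y) x = mD v A x - mD v B x.
Proof. by move=> dA dB; rewrite mD_D ?mD_N//; exact: mdiffN. Qed.

Lemma mD_M a b c (A : V -> 'M[R]_(a, b)) (B : V -> 'M[R]_(b, c)) x v :
  mdiff A x -> mdiff B x ->
  mD v (fun y => A y *m B y) x = mD v A x *m B x + A x *m mD v B x.
Proof.
move=> dA dB; apply/matrixP => i j; rewrite !mxE.
under eq_fun do rewrite mxE.
rewrite derive_fsum => [|k]; last exact: differentiableM.
by rewrite -big_split; apply: eq_bigr => k _ /=; rewrite derive_fM// !mxE.
Qed.

Lemma mD_Z a b (f : V -> R) (A : V -> 'M[R]_(a, b)) x v :
  differentiable f x -> mdiff A x ->
  mD v (fun y => f y *: A y) x = 'D_v f x *: A x + f x *: mD v A x.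
Proof.
move=> df dA; apply/matrixP => i j; rewrite !mxE.
by under eq_fun do rewrite mxE; rewrite derive_fM.
Qed.

Lemma mD_tr a b (A : V -> 'M[R]_(a, b)) x v :
  mD v (fun y => (A y)^T) x = (mD v A x)^T.
Proof.
apply/matrixP => i j; rewrite !mxE.
by under eq_fun do rewrite mxE.
Qed.

Lemma near_mdiff a b (A B : V -> 'M[R]_(a, b)) x :
  (\near x, A x = B x) -> mdiff A x -> mdiff B x.
Proof.
move=> AB dA i j; apply: near_differentiable (dA i j).
by apply: filterS AB => y ->.
Qed.

Lemma near_mD a b (A B : V -> 'M[R]_(a, b)) x v :
  (\near x, A x = B x) -> mD v A x = mD v B x.
Proof.
move=> AB; apply/matrixP => i j; rewrite !mxE; apply: near_eq_derive.
by apply: filterS AB => y ->.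
Qed.

Lemma derive_dirZ (f : V -> R) x (k : R) v : differentiable f x ->
  'D_(k *: v) f x = k * 'D_v f x.
Proof. by move=> df; rewrite !deriveE// linearZ. Qed.

Lemma derive_dir_sum (I : finType) (f : V -> R) x (v : I -> V) :
  differentiable f x -> 'D_(\sum_i v i) f x = \sum_i 'D_(v i) f x.
Proof.
move=> df; rewrite deriveE// linear_sum; apply: eq_bigr => i _.
by rewrite deriveE.
Qed.

Lemma differentiable_mx a b (A : V -> 'M[R]_(a, b)) x :
  mdiff A x -> differentiable A x.
Proof.
move=> dA; have -> : A = \sum_(i < a) \sum_(j < b)
    (fun y => A y i j *: (delta_mx i j : 'M[R]_(a, b))).
  apply/funext => y; rewrite fct_sumE [LHS]matrix_sum_delta.
  by apply: eq_bigr => i _; rewrite fct_sumE.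
apply: differentiable_sum => i; apply: differentiable_sum => j.
exact: differentiableZl.
Qed.

Lemma mDE a b (A : V -> 'M[R]_(a, b)) x v : mdiff A x -> mD v A x = 'D_v A x.
Proof. by move=> /differentiable_mx dA; rewrite derive_mx//; exact: diff_derivable. Qed.

Lemma differentiable_chain m (F : V -> 'rV[R]_m) (H : 'rV[R]_m -> R) x :
  mdiff F x -> differentiable H (F x) -> differentiable (fun y => H (F y)) x.
Proof. by move=> /differentiable_mx dF dH; exact: differentiable_comp. Qed.

Lemma derive_chain m (F : V -> 'rV[R]_m) (H : 'rV[R]_m -> R) x v :
  mdiff F x -> differentiable H (F x) ->
  'D_v (fun y => H (F y)) x = 'D_(mD v F x) H (F x).
Proof.
move=> dF dH; have dF' := differentiable_mx dF.
have dHF : differentiable (H \o F) x by exact: differentiable_comp.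
rewrite (deriveE v dHF) diff_comp//= mDE// [RHS]deriveE//.
by rewrite [in RHS]deriveE.
Qed.

Lemma mdiff_chain m a b (F : V -> 'rV[R]_m) (A : 'rV[R]_m -> 'M[R]_(a, b)) x :
  mdiff F x -> mdiff A (F x) -> mdiff (fun y => A (F y)) x.
Proof. by move=> dF dA i j; apply: (differentiable_chain dF (dA i j)). Qed.

Lemma mD_chain m a b (F : V -> 'rV[R]_m) (A : 'rV[R]_m -> 'M[R]_(a, b)) x v :
  mdiff F x -> mdiff A (F x) -> mD v (fun y => A (F y)) x = mD (mD v F x) A (F x).
Proof.
by move=> dF dA; apply/matrixP => i j; rewrite !mxE -(derive_chain v dF (dA i j)).
Qed.

Lemma differentiable_det n (A : V -> 'M[R]_n) x :
  mdiff A x -> differentiable (fun y => \det (A y)) x.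
Proof.
move=> dA; rewrite /determinant; apply: differentiable_fsum => s.
apply: differentiableM; first exact: differentiable_cst.
exact: differentiable_fprod.
Qed.

(** Cramer's rule: near [x] the inverse is the adjugate divided by the determinant, both polynomial
    in the entries. *)
Lemma mdiff_inv n (A : V -> 'M[R]_n) x :
  mdiff A x -> (\near x, A x \in unitmx) -> mdiff (fun y => invmx (A y)) x.
Proof.
move=> dA uA.
apply: (@near_mdiff _ _ (fun y => (\det (A y))^-1 *: \adj (A y))).
  by apply: filterS uA => y uAy; rewrite /invmx uAy.
apply: mdiffZ.
  apply: differentiableV; first exact: differentiable_det.
  by have := nbhs_singleton uA; rewrite unitmxE unitfE.
move=> i j; under eq_fun do rewrite mxE; rewrite /cofactor.
apply: differentiableM; first exact: differentiable_cst.
apply: differentiable_det => k l; under eq_fun do rewrite !mxE; exact: dA.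
Qed.

End MRules.

Lemma derive_row n (f : 'rV[R]_n -> R) x (v : 'rV[R]_n) : differentiable f x ->
  'D_v f x = \sum_i v 0 i * partial i f x.
Proof.
move=> df; rewrite {1}[v]row_sum_delta derive_dir_sum//.
by apply: eq_bigr => i _; rewrite derive_dirZ.
Qed.

End MatrixCalculus.

(** * Smooth functions and maps on open subsets of R^n *)

Section Smooth.
Context {R : realType} {n : nat} (U : set 'rV[R]_n) (oU : open U).
Implicit Types (F : 'rV[R]_n -> R) (x v w : 'rV[R]_n).

Lemma open_near x : U x -> \near x, U x.
Proof. by move=> Ux; apply: open_nbhs_nbhs. Qed.

Lemma smooth_partial F i : smooth_on U F -> smooth_on U (partial i F).
Proof. by move=> sF k; have [_ /(_ i)[]] := sF k.+1. Qed.

Lemma smooth_continuous F x : smooth_on U F -> U x -> {for x, continuous F}.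
Proof. by move=> /(_ 0%N)[+ _]; apply. Qed.

(** [smooth_on] only speaks of partial derivatives along the axes; the C^1 criterion upgrades them
    to a full differential. *)
Lemma smooth_differentiable F x : smooth_on U F -> U x -> differentiable F x.
Proof.
move=> sF Ux; apply: C1_differentiable => [|i].
  apply: filterS (open_near Ux) => y Uy i.
  by have [_ /(_ i)[]] := sF 1%N; move=> /(_ y Uy).
exact: smooth_continuous (smooth_partial i sF) Ux.
Qed.

Lemma near_smooth_derive F x v : smooth_on U F -> U x ->
  \near x, 'D_v F x = \sum_i v 0 i * partial i F x.
Proof.
move=> sF Ux; apply: filterS (open_near Ux) => y Uy.
exact/derive_row/smooth_differentiable.
Qed.

Lemma smooth_derive_differentiable F x v : smooth_on U F -> U x ->
  differentiable ('D_v F) x.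
Proof.
move=> sF Ux.
apply: (@near_differentiable _ _ (fun y => \sum_i v 0 i * partial i F y)).
  by apply: filterS (near_smooth_derive v sF Ux) => y ->.
apply: differentiable_fsum => i; apply: differentiableM.
  exact: differentiable_cst.
exact: smooth_differentiable (smooth_partial i sF) Ux.
Qed.

Lemma smooth_schwarz_coord F x i j : smooth_on U F -> U x ->
  partial j (partial i F) x = partial i (partial j F) x.
Proof.
move=> sF Ux; apply: schwarz.
- apply: filterS (open_near Ux) => y Uy.
  by split; apply: diff_derivable; apply: smooth_differentiable => //;
    exact: smooth_partial.
- by apply: smooth_continuous Ux; do 2 apply: smooth_partial.
- by apply: smooth_continuous Ux; do 2 apply: smooth_partial.
Qed.

Lemma smooth_derive2 F x v w : smooth_on U F -> U x ->
  'D_v ('D_w F) x = \sum_j \sum_i w 0 j * v 0 i * partial i (partial j F) x.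
Proof.
move=> sF Ux.
rewrite (near_eq_derive _ (near_smooth_derive w sF Ux)).
have dp j : differentiable (partial j F) x.
  exact: smooth_differentiable (smooth_partial j sF) Ux.
rewrite derive_fsum => [|j]; last first.
  by apply: differentiableM; [exact: differentiable_cst|exact: dp].
apply: eq_bigr => j _; rewrite derive_fM; [|exact: differentiable_cst|exact: dp].
rewrite derive_cst mul0r add0r derive_row// mulr_sumr.
by apply: eq_bigr => i _; rewrite mulrA.
Qed.

Lemma smooth_schwarz F x v w : smooth_on U F -> U x ->
  'D_v ('D_w F) x = 'D_w ('D_v F) x.
Proof.
move=> sF Ux; rewrite !smooth_derive2// exchange_big.
apply: eq_bigr => i _; apply: eq_bigr => j _.
by rewrite (smooth_schwarz_coord i j sF Ux) [w 0 j * _]mulrC.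
Qed.

End Smooth.

Section SmoothMap.
Context {R : realType} {n m : nat} (U : set 'rV[R]_n) (oU : open U).
Variable F : 'rV[R]_n -> 'rV[R]_m.
Hypothesis sF : forall a, smooth_on U (Defs.comp F a).
Implicit Types (x v w : 'rV[R]_n).

Lemma smooth_map_mdiff x : U x -> mdiff F x.
Proof. by move=> Ux i j; rewrite ord1; exact: smooth_differentiable (sF j) Ux. Qed.

Lemma smooth_map_mD x v : U x -> mD v F x = v *m dmap F x.
Proof.
move=> Ux; apply/rowP => a; rewrite !mxE derive_row; last first.
  exact: smooth_differentiable (sF a) Ux.
by apply: eq_bigr => i _; rewrite mxE.
Qed.

Lemma smooth_dmap i a : smooth_on U (fun x => dmap F x i a).
Proof.
have -> : (fun x => dmap F x i a) = partial i (Defs.comp F a).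
  by apply/funext => x; rewrite mxE.
exact: smooth_partial.
Qed.

Lemma dmap_mdiff x : U x -> mdiff (dmap F) x.
Proof. by move=> Ux i a; exact: smooth_differentiable (smooth_dmap i a) Ux. Qed.

Lemma mD_dmap_mdiff x v : U x -> mdiff (mD v (dmap F)) x.
Proof.
move=> Ux i a; under eq_fun do rewrite mxE.
exact: (smooth_derive_differentiable oU v (smooth_dmap i a) Ux).
Qed.

(** Symmetry of third derivatives of [F]; it cancels the highest-order term when the derivative of
    [II] is antisymmetrized. *)
Lemma mD_dmap_schwarz x v w : U x ->
  mD v (mD w (dmap F)) x = mD w (mD v (dmap F)) x.
Proof.
move=> Ux; apply/matrixP => i a.
have E u z : mD u (mD z (dmap F)) x i a = 'D_u ('D_z (fun y => dmap F y i a)) x.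
  by rewrite mDij; congr ('D_u _ x); apply/funext => y; exact: mDij.
apply: etrans (E v w) _; apply: etrans _ (esym (E w v)).
exact: (smooth_schwarz oU v w (smooth_dmap i a) Ux).
Qed.

(** Second derivatives of [F] commute; this is the source of the symmetry of [II]. *)
Lemma mD_dmap_sym x v w : U x -> w *m mD v (dmap F) x = v *m mD w (dmap F) x.
Proof.
move=> Ux; apply/rowP => a; rewrite [LHS]mxE [RHS]mxE.
have E u i : (mD u (dmap F) x) i a = 'D_u (partial i (Defs.comp F a)) x.
  rewrite mDij; congr ('D_u _ x).
  by apply/funext => y; rewrite mxE.
have dp i : differentiable (partial i (Defs.comp F a)) x.
  exact: smooth_differentiable (smooth_partial i (sF a)) Ux.
transitivity (\sum_i \sum_j w 0 i * (v 0 j * partial j (partial i (Defs.comp F a)) x)).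
  by apply: eq_bigr => i _; rewrite E derive_row// mulr_sumr.
transitivity (\sum_i \sum_j v 0 i * (w 0 j * partial j (partial i (Defs.comp F a)) x)).
  rewrite exchange_big; apply: eq_bigr => i _; apply: eq_bigr => j _.
  by rewrite (smooth_schwarz_coord oU j i (sF a) Ux) mulrCA.
by apply: eq_bigr => i _; rewrite E derive_row// mulr_sumr.
Qed.

End SmoothMap.

(** * The Gauss equation *)

Section BilinearForms.
Context {R : realType}.

Lemma form_tr n m (A : 'M[R]_(n, m)) (v : 'rV[R]_n) (w : 'rV[R]_m) :
  (v *m A *m w^T) 0 0 = (w *m A^T *m v^T) 0 0.
Proof.
have -> : w *m A^T *m v^T = (v *m A *m w^T)^T.
  by rewrite !trmx_mul trmxK mulmxA.
by rewrite [RHS]mxE.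
Qed.

Lemma form_eq0 n m (A : 'M[R]_(n, m)) :
  (forall (v : 'rV_n) (w : 'rV_m), (v *m A *m w^T) 0 0 = 0) -> A = 0.
Proof.
move=> H; apply/matrixP => i j; rewrite mxE.
by have := H (delta_mx 0 i) (delta_mx 0 j); rewrite -rowE trmx_delta -colE !mxE.
Qed.

(** The form [(w *m E v *m z^T) 0 0] is symmetric in [v, w] and antisymmetric in [w, z]. Alternating
    the two exchanges three times restores the arguments with the opposite sign. *)
Lemma trilinear0 n (E : 'rV[R]_n -> 'M[R]_n) :
  (forall v, (E v)^T = - E v) -> (forall v w : 'rV_n, w *m E v = v *m E w) ->
  forall v, E v = 0.
Proof.
move=> anti sym v; apply: form_eq0 => w z.
have an u (a b : 'rV_n) : (a *m E u *m b^T) 0 0 = - (b *m E u *m a^T) 0 0.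
  by rewrite form_tr anti mulmxN mulNmx mxE.
set t := LHS; suff : t = - t by move=> tt; lra.
by rewrite {1}/t sym an sym an opprK sym an.
Qed.

End BilinearForms.

Section Connection.
Context {R : realType} {n : nat}.
Implicit Types (g : 'rV[R]_n -> 'M[R]_n) (C : 'rV[R]_n -> 'rV[R]_n -> 'M[R]_n).

(* [C v] is the matrix of the connection form in the direction of the constant
   field [v], so that the field [w], a row vector, has covariant derivative
   [D_v w + w *m C v]. *)
Record levi_civita g C (x : 'rV[R]_n) : Prop := {
  lc_sym : (g x)^T = g x;
  lc_gdiff : mdiff g x;
  lc_diff : forall v, mdiff (C v) x;
  lc_torsion : forall v w : 'rV_n, w *m C v x = v *m C w x;
  lc_metric : forall v, mD v g x = C v x *m g x + (C v x *m g x)^T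
}.

(** Linearity in the direction is written in coordinates because directions such as [v *m J x] vary
    with [x] and get differentiated. *)
Definition conn_linear C := forall v x, C v x = \sum_i v 0 i *: C (delta_mx 0 i) x.

(** Constant fields commute, so there is no bracket term. As matrices act from the right,
    [D_v D_w z] contributes [z *m C w *m C v], hence the order of the products. *)
Definition curvature C (v w x : 'rV[R]_n) : 'M[R]_n :=
  mD v (C w) x - mD w (C v) x + C w x *m C v x - C v x *m C w x.

(** Uniqueness of the Levi-Civita connection with the index lowered: the difference of two solutions
    is antisymmetric and torsion-free, so [trilinear0] kills it. *)
Lemma koszul_unique (A B : 'rV[R]_n -> 'M[R]_n) :
  (forall v, A v + (A v)^T = B v + (B v)^T) ->
  (forall v w : 'rV_n, w *m A v = v *m A w) ->
  (forall v w : 'rV_n, w *m B v = v *m B w) ->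
  forall v, A v = B v.
Proof.
move=> AB sA sB v; apply/eqP; rewrite -subr_eq0; apply/eqP.
apply: (@trilinear0 _ _ (fun v => A v - B v)) => [u|u w].
  have E : (A u)^T = B u + (B u)^T - A u by rewrite -AB addrC addKr.
  by rewrite linearB /= opprB E addrAC addrK.
by rewrite !mulmxBr sA sB.
Qed.

End Connection.

(** * Matrix identities behind the Gauss equation *)

Section GaussAlgebra.
Context {R : realType} {n m : nat}.

(** Here [a2] is the common value of [D_v D_w J] and [D_w D_v J], [Jv] and [Jw] are derivatives of
    [J], and [cvw], [ovw] those of the connections of source and target. [k] comes from
    differentiating the direction in which the target connection is taken; it is symmetric in [v, w]
    and cancels. *)
Lemma covariant_derivative_anti (J Jv Jw a2 : 'M[R]_(n, m))
    (Wv Ww k ovw owv : 'M[R]_m) (Cv Cw cvw cwv : 'M[R]_n) :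
  a2 + (Jv *m Ww + J *m (k + ovw)) - (cvw *m J + Cw *m Jv)
    + (Jw + J *m Ww - Cw *m J) *m Wv
  - (a2 + (Jw *m Wv + J *m (k + owv)) - (cwv *m J + Cv *m Jw)
    + (Jv + J *m Wv - Cv *m J) *m Ww) =
  J *m (ovw - owv + Ww *m Wv - Wv *m Ww)
  - (cvw - cwv + Cw *m Cv - Cv *m Cw) *m J
  - Cw *m (Jv + J *m Wv - Cv *m J) + Cv *m (Jw + J *m Ww - Cw *m J).
Proof.
rewrite !(mulmxDl, mulmxBl, mulmxDr, mulmxBr, mulmxN, mulNmx) !mulmxA.
apply/matrixP => i j.
repeat match goal with |- context [?A *m ?B] => move: (A *m B) => ? end.
by rewrite !mxE; ring.
Qed.

(* [P] and [Q] stand for [D_v (II w)] and [D_w (II v)]; their tangential parts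
   come from differentiating [<II, dF> = 0]. *)
Lemma gauss_algebra (J P Q Sv Sw : 'M[R]_(n, m)) (Om G : 'M[R]_m)
    (Th Cv Cw : 'M[R]_n) :
  P - Q = J *m Om - Th *m J - Cw *m Sv + Cv *m Sw ->
  P *m G *m J^T = - (Sw *m G *m Sv^T) -> Q *m G *m J^T = - (Sv *m G *m Sw^T) ->
  Sv *m G *m J^T = 0 -> Sw *m G *m J^T = 0 ->
  Th *m (J *m G *m J^T) =
    J *m Om *m G *m J^T + Sw *m G *m Sv^T - Sv *m G *m Sw^T.
Proof.
move=> /(congr1 (fun M => M *m G *m J^T)) + HP HQ Hv Hw.
rewrite !mulmxDl !mulNmx HP HQ -!(mulmxA Cw) -!(mulmxA Cv) Hv Hw !mulmx0 !mulmxA.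
move: (Th *m _ *m _ *m _) (J *m Om *m _ *m _) => A B.
move: (Sw *m _ *m _) (Sv *m _ *m _) => X Y E.
apply/matrixP => i j; move/matrixP/(_ i j): E; rewrite !mxE => E.
by rewrite -[LHS]opprK; lra.
Qed.

End GaussAlgebra.

Section Gauss.
Context {R : realType} {n m : nat} (U : set 'rV[R]_n) (oU : open U).
Variables (F : 'rV[R]_n -> 'rV[R]_m) (J : 'rV[R]_n -> 'M[R]_(n, m)).
Variables (g : 'rV[R]_n -> 'M[R]_n) (C : 'rV[R]_n -> 'rV[R]_n -> 'M[R]_n).
Variables (G : 'rV[R]_m -> 'M[R]_m) (W : 'rV[R]_m -> 'rV[R]_m -> 'M[R]_m).
Hypothesis dF : forall x, U x -> mdiff F x.
Hypothesis DF : forall x v, U x -> mD v F x = v *m J x.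
Hypothesis dJ : forall x, U x -> mdiff J x.
Hypothesis dDJ : forall x v, U x -> mdiff (mD v J) x.
Hypothesis symJ : forall x v w, U x -> w *m mD v J x = v *m mD w J x.
Hypothesis schwarzJ : forall x v w, U x -> mD v (mD w J) x = mD w (mD v J) x.
Hypothesis lcC : forall x, U x -> levi_civita g C x.
Hypothesis lcW : forall x, U x -> levi_civita G W (F x).
Hypothesis linW : conn_linear W.
Hypothesis gJ : forall x, U x -> g x = J x *m G (F x) *m (J x)^T.

(** Connection form of the pullback along [F] of the tangent bundle of the target. *)
Definition Wpull (v x : 'rV[R]_n) : 'M[R]_m := W (v *m J x) (F x).

(* Row [w] of [sff v x] is the second fundamental form [II(v, w)]. *)
Definition sff (v x : 'rV[R]_n) : 'M[R]_(n, m) :=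
  mD v J x + J x *m Wpull v x - C v x *m J x.

Lemma sff_sym x v w : U x -> w *m sff v x = v *m sff w x.
Proof.
move=> Ux; rewrite !mulmxBr !mulmxDr (symJ v w Ux) !mulmxA.
by rewrite (lc_torsion (lcC Ux) v w) (lc_torsion (lcW Ux) (v *m J x)).
Qed.

Lemma mD_GF x v : U x ->
  mD v (fun y => G (F y)) x =
  Wpull v x *m G (F x) + (Wpull v x *m G (F x))^T.
Proof.
by move=> Ux; rewrite mD_chain ?DF ?(lc_metric (lcW Ux))//;
  [exact: dF|exact: lc_gdiff (lcW Ux)].
Qed.

Lemma mdiff_GF x : U x -> mdiff (fun y => G (F y)) x.
Proof. by move=> Ux; apply: mdiff_chain; [exact: dF|exact: lc_gdiff (lcW Ux)]. Qed.

(** Metric compatibility of the pulled back connection, for the pairing of a field [A] along [F]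
    with the image of the differential. *)
Lemma mD_JGJ p x v (A : 'rV[R]_n -> 'M[R]_(p, m)) : U x -> mdiff A x ->
  mD v (fun y => A y *m G (F y) *m (J y)^T) x =
  (mD v A x + A x *m Wpull v x) *m G (F x) *m (J x)^T +
  A x *m G (F x) *m (mD v J x + J x *m Wpull v x)^T.
Proof.
move=> Ux dA.
rewrite mD_M; [|by apply: mdiffM => //; exact: mdiff_GF|exact/mdiff_tr/dJ].
rewrite mD_M//; last exact: mdiff_GF.
rewrite mD_GF// mD_tr !linearD /= !trmx_mul (lc_sym (lcW Ux)).
rewrite !(mulmxDl, mulmxDr) !mulmxA -!addrA; congr (_ + (_ + _)).
exact: addrC.
Qed.

(** The tangential part of the derivative of [J], paired with [J], satisfies the torsion and metric
    identities that determine [C v *m g x]; [koszul_unique] equates the two. *)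
Lemma sff_normal x v : U x -> sff v x *m G (F x) *m (J x)^T = 0.
Proof.
move=> Ux; rewrite !mulmxBl; apply/eqP; rewrite subr_eq0; apply/eqP.
have -> : C v x *m J x *m G (F x) *m (J x)^T = C v x *m g x.
  by rewrite gJ// !mulmxA.
apply: (@koszul_unique _ _
  (fun v => (mD v J x + J x *m Wpull v x) *m G (F x) *m (J x)^T)
  (fun v => C v x *m g x)) => [u|u w|u w].
- rewrite -(lc_metric (lcC Ux)).
  have -> : mD u g x = mD u (fun y => J y *m G (F y) *m (J y)^T) x.
    by apply: near_mD; apply: filterS (open_near oU Ux) => y; exact: gJ.
  rewrite mD_JGJ//; last exact: dJ.
  by congr (_ + _); rewrite !trmx_mul trmxK (lc_sym (lcW Ux)) mulmxA.
- rewrite !mulmxA !mulmxDr (symJ u w Ux) !mulmxA.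
  by rewrite (lc_torsion (lcW Ux) (u *m J x)).
- by rewrite !mulmxA (lc_torsion (lcC Ux) u w).
Qed.

Lemma mdiff_mulJ x (v : 'rV[R]_n) : U x -> mdiff (fun y => v *m J y) x.
Proof. by move=> Ux; apply: mdiffM; [exact: mdiff_cst|exact: dJ]. Qed.

Lemma mdiff_Wpull x v : U x -> mdiff (Wpull v) x.
Proof.
move=> Ux i j; rewrite /Wpull; under eq_fun do rewrite linW summxE.
apply: differentiable_fsum => b; under eq_fun do rewrite mxE.
apply: differentiableM; first exact: mdiff_mulJ.
exact: (mdiff_chain (dF Ux) (lc_diff (lcW Ux) _)).
Qed.

(** Both the base point [F x] and the direction [w *m J x] move: the first summand differentiates
    the direction, the second the point with the direction frozen. *)
Lemma mD_Wpull x v w : U x ->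
  mD v (Wpull w) x = W (w *m mD v J x) (F x) + mD (v *m J x) (W (w *m J x)) (F x).
Proof.
move=> Ux; have dWF b := mdiff_chain (dF Ux) (lc_diff (lcW Ux) (delta_mx 0 b)).
have dwJ := mdiff_mulJ w Ux.
apply/matrixP => i j; rewrite mDij.
transitivity ('D_v (fun y => \sum_b (w *m J y) 0 b * W (delta_mx 0 b) (F y) i j) x).
  congr ('D_v _ x); apply/funext => y; rewrite /Wpull linW summxE.
  by apply: eq_bigr => b _; rewrite mxE.
rewrite derive_fsum => [|b]; last by apply: differentiableM; [exact: dwJ|exact: dWF].
rewrite mxE mDij.
have -> : (fun y => W (w *m J x) y i j) =
    (fun y => \sum_b (w *m J x) 0 b * W (delta_mx 0 b) y i j).
  apply/funext => y; rewrite linW summxE.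
  by apply: eq_bigr => b _; rewrite mxE.
rewrite derive_fsum => [|b]; last first.
  by apply: differentiableM; [exact: differentiable_cst|exact: (lc_diff (lcW Ux))].
rewrite linW summxE -big_split; apply: eq_bigr => b _ /=.
rewrite derive_fM; [|exact: dwJ|exact: dWF].
rewrite derive_fM; [|exact: differentiable_cst|exact: (lc_diff (lcW Ux))].
rewrite derive_cst mul0r add0r [in RHS]mxE; congr (_ * _ + _ * _).
- have := mD_M v (mdiff_cst w x) (dJ Ux).
  by rewrite mD_cst mul0mx add0r => /(congr1 (fun M : 'rV_m => M 0 b)) <-; rewrite mDij.
- have /= -> := derive_chain v (dF Ux) (lc_diff (lcW Ux) (delta_mx 0 b) i j).
  by rewrite DF.
Qed.

Lemma mdiff_sff x v : U x -> mdiff (sff v) x.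
Proof.
move=> Ux; apply: mdiffB; first apply: mdiffD; first exact: dDJ.
  by apply: mdiffM; [exact: dJ|exact: mdiff_Wpull].
by apply: mdiffM; [exact: (lc_diff (lcC Ux))|exact: dJ].
Qed.

(** Only the values of [II] are differentiated covariantly. The corrections for its tangent
    arguments show up as the last two terms of [Dsff_anti], and they are normal. *)
Definition Dsff (v w x : 'rV[R]_n) := mD v (sff w) x + sff w x *m Wpull v x.

(** Derivative of the identity [sff_normal]: the covariant derivative of [J] is
    [sff v x + C v x *m J x], and its tangential part pairs to zero with [sff w x]. *)
Lemma Dsff_tangent x v w : U x ->
  Dsff v w x *m G (F x) *m (J x)^T = - (sff w x *m G (F x) *m (sff v x)^T).
Proof.
move=> Ux; apply/eqP; rewrite -addr_eq0; apply/eqP.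
have : mD v (fun y => sff w y *m G (F y) *m (J y)^T) x = 0.
  transitivity (mD v (fun _ : 'rV[R]_n => 0 : 'M[R]_n) x); last exact: mD_cst.
  by apply: near_mD; apply: filterS (open_near oU Ux) => y; exact: sff_normal.
rewrite mD_JGJ//; last exact: mdiff_sff.
move=> <-; congr (_ + _).
have -> : mD v J x + J x *m Wpull v x = sff v x + C v x *m J x by rewrite subrK.
rewrite [(sff v x + _)^T]linearD /= mulmxDr trmx_mul [X in _ = _ + X]mulmxA.
by rewrite sff_normal// mul0mx addr0.
Qed.

Lemma mD_sff x v w : U x ->
  mD v (sff w) x = mD v (mD w J) x + (mD v J x *m Wpull w x + J x *m mD v (Wpull w) x)
    - (mD v (C w) x *m J x + C w x *m mD v J x).
Proof.
move=> Ux; rewrite /sff mD_B; first last.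
- by apply: mdiffM; [exact: (lc_diff (lcC Ux))|exact: dJ].
- apply: mdiffD; first exact: dDJ.
  by apply: mdiffM; [exact: dJ|exact: mdiff_Wpull].
rewrite mD_D; first last.
- by apply: mdiffM; [exact: dJ|exact: mdiff_Wpull].
- exact: dDJ.
by rewrite !mD_M//; [exact: (lc_diff (lcC Ux))|exact: dJ|exact: dJ|exact: mdiff_Wpull].
Qed.

(** The Gauss and Codazzi equations before they are split into tangential and normal parts. *)
Lemma Dsff_anti x v w : U x ->
  Dsff v w x - Dsff w v x = J x *m curvature W (v *m J x) (w *m J x) (F x)
    - curvature C v w x *m J x - C w x *m sff v x + C v x *m sff w x.
Proof.
move=> Ux; rewrite /Dsff !mD_sff// (schwarzJ v w Ux) !mD_Wpull//.
rewrite (symJ v w Ux); exact: covariant_derivative_anti.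
Qed.

Lemma gauss x v w : U x ->
  curvature C v w x *m g x =
    J x *m curvature W (v *m J x) (w *m J x) (F x) *m G (F x) *m (J x)^T
    + sff w x *m G (F x) *m (sff v x)^T - sff v x *m G (F x) *m (sff w x)^T.
Proof.
move=> Ux.
rewrite (gJ Ux); apply: (gauss_algebra (Dsff_anti v w Ux)).
- exact: Dsff_tangent.
- exact: Dsff_tangent.
- exact: sff_normal.
- exact: sff_normal.
Qed.

End Gauss.

(** * Christoffel symbols *)

Section Christoffel.
Context {R : realType} {n : nat} (g : 'rV[R]_n -> 'M[R]_n).
Implicit Types (u v w x : 'rV[R]_n).

Definition conn (v x : 'rV[R]_n) : 'M[R]_n :=
  \matrix_(j, k) \sum_i v 0 i * christoffel g k i j x.

(** Christoffel symbols of the first kind, contracted with the direction; without the inverse metric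
    the torsion and metric identities are linear in the derivatives of [g]. *)
Definition conn_lower (v x : 'rV[R]_n) : 'M[R]_n :=
  \matrix_(j, l) \sum_i v 0 i * (2^-1 *
    (partial i (fun y => g y j l) x + partial j (fun y => g y i l) x
     - partial l (fun y => g y i j) x)).

(** Symmetry and invertibility are required near [x] because they get differentiated: the first
    makes the derivatives of [g] symmetric, the second gives a derivative to the inverse. *)
Record smooth_metric_at x : Prop := {
  sm_sym : \near x, (g x)^T = g x;
  sm_unit : \near x, g x \in unitmx;
  sm_diff : \near x, mdiff g x;
  sm_diff2 : forall i j k, differentiable (partial i (fun y => g y j k)) x
}.

Lemma conn_linearE : conn_linear conn.
Proof.
move=> v x; apply/matrixP => j k; rewrite summxE mxE; apply: eq_bigr => i _.
rewrite !mxE (bigD1 i)//= mxE !eqxx mul1r big1 ?addr0// => l li.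
by rewrite mxE eqxx (negPf li) mul0r.
Qed.

Lemma connE v x : conn v x = conn_lower v x *m (invmx (g x))^T.
Proof.
apply/matrixP => j k; rewrite !mxE.
under [RHS]eq_bigr do rewrite !mxE mulr_suml.
rewrite exchange_big; apply: eq_bigr => i _ /=.
rewrite /christoffel !mulr_sumr; apply: eq_bigr => l _.
by ring.
Qed.

Lemma conn_lower_metric v x : smooth_metric_at x ->
  conn_lower v x + (conn_lower v x)^T = mD v g x.
Proof.
move=> sm; apply/matrixP => j l; rewrite mDij derive_row; last first.
  exact: (nbhs_singleton (sm_diff sm)).
rewrite !mxE -big_split; apply: eq_bigr => i _ /=.
have E a b c : partial a (fun y => g y b c) x = partial a (fun y => g y c b) x.
  apply: near_eq_derive; apply: filterS (sm_sym sm) => y gy.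
  by rewrite -{1}gy mxE.
rewrite (E i l j).
by lra.
Qed.

Lemma sum_row_mul (f : 'I_n -> 'I_n -> R) v w :
  (forall i j, f i j = f j i) ->
  \sum_j w 0 j * (\sum_i v 0 i * f i j) = \sum_j v 0 j * (\sum_i w 0 i * f i j).
Proof.
move=> fs; under eq_bigr do rewrite mulr_sumr.
rewrite exchange_big; apply: eq_bigr => i _; rewrite mulr_sumr.
by apply: eq_bigr => j _; rewrite fs mulrCA.
Qed.

Lemma conn_lower_torsion v w x : smooth_metric_at x ->
  w *m conn_lower v x = v *m conn_lower w x.
Proof.
move=> sm; apply/rowP => l; rewrite !mxE.
under eq_bigr do rewrite mxE.
under [RHS]eq_bigr do rewrite mxE.
apply: sum_row_mul => i j.
have E a b c : partial a (fun y => g y b c) x = partial a (fun y => g y c b) x.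
  apply: near_eq_derive; apply: filterS (sm_sym sm) => y gy.
  by rewrite -{1}gy mxE.
by rewrite (E l i j) [X in _ * (X - _)]addrC.
Qed.

Lemma inv_sym x : smooth_metric_at x -> (invmx (g x))^T = invmx (g x).
Proof. by move=> /sm_sym/nbhs_singleton gx; rewrite trmx_inv gx. Qed.

Lemma conn_lowerE v x : smooth_metric_at x -> conn v x *m g x = conn_lower v x.
Proof.
move=> sm; rewrite connE inv_sym// mulmxKV//.
exact: (nbhs_singleton (sm_unit sm)).
Qed.

Lemma christoffel_diff x i j k : smooth_metric_at x ->
  differentiable (christoffel g k i j) x.
Proof.
move=> sm; rewrite /christoffel; apply: differentiableM.
  exact: differentiable_cst.
apply: differentiable_fsum => l; apply: differentiableM.
  exact: mdiff_inv (nbhs_singleton (sm_diff sm)) (sm_unit sm) k l.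
apply: differentiableB; last exact: sm_diff2 sm _ _ _.
by apply: differentiableD; exact: sm_diff2 sm _ _ _.
Qed.

Lemma conn_mdiff v x : smooth_metric_at x -> mdiff (conn v) x.
Proof.
move=> sm j k; under eq_fun do rewrite mxE.
apply: differentiable_fsum => i; apply: differentiableM.
  exact: differentiable_cst.
exact: christoffel_diff.
Qed.

Lemma conn_levi_civita x : smooth_metric_at x -> levi_civita g conn x.
Proof.
move=> sm; split.
- exact: nbhs_singleton (sm_sym sm).
- exact: nbhs_singleton (sm_diff sm).
- by move=> v; exact: conn_mdiff.
- by move=> v w; rewrite !connE !mulmxA conn_lower_torsion.
- by move=> v; rewrite conn_lowerE// conn_lower_metric.
Qed.

(** Multiplication by the invertible [g x] lowers the index and reduces the claim to
    [koszul_unique]. *)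
Lemma levi_civita_unique (C : 'rV[R]_n -> 'M[R]_n) x v : smooth_metric_at x ->
  (forall v w : 'rV_n, w *m C v = v *m C w) ->
  (forall v, mD v g x = C v *m g x + (C v *m g x)^T) ->
  C v = conn v x.
Proof.
move=> sm tC mC; have ug := nbhs_singleton (sm_unit sm).
rewrite -[LHS](mulmxK ug) -[RHS](mulmxK ug); congr (_ *m _).
apply: (@koszul_unique _ _ (fun v => C v *m g x) (fun v => conn v x *m g x)).
- by move=> u; rewrite -mC (lc_metric (conn_levi_civita sm)).
- by move=> u w; rewrite !mulmxA tC.
- by move=> u w; rewrite !mulmxA (lc_torsion (conn_levi_civita sm)).
Qed.

Lemma conn_derive v w x j k : smooth_metric_at x ->
  mD v (conn w) x j k =
  \sum_a \sum_b v 0 a * w 0 b * partial a (christoffel g k b j) x.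
Proof.
move=> sm; rewrite mDij; under eq_fun do rewrite mxE.
rewrite derive_fsum => [|i]; last first.
  by apply: differentiableM; [exact: differentiable_cst|exact: christoffel_diff].
rewrite exchange_big; apply: eq_bigr => b _ /=.
rewrite derive_fM; [|exact: differentiable_cst|exact: christoffel_diff].
rewrite derive_cst mul0r add0r derive_row ?mulr_sumr; last exact: christoffel_diff.
by apply: eq_bigr => a _; rewrite mulrCA mulrA.
Qed.

Lemma conn_mul v w x j k :
  (conn w x *m conn v x) j k = \sum_a \sum_b v 0 a * w 0 b *
    \sum_m christoffel g k a m x * christoffel g m b j x.
Proof.
rewrite mxE; under eq_bigr do rewrite !mxE mulr_suml.
under eq_bigr do under eq_bigr do rewrite mulr_sumr.
under [RHS]eq_bigr do under eq_bigr do rewrite mulr_sumr.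
rewrite exchange_big.
under eq_bigr do rewrite exchange_big.
rewrite exchange_big; apply: eq_bigr => a _; apply: eq_bigr => b _ /=.
by apply: eq_bigr => m _; ring.
Qed.

(** Dictionary with the index notation: the row [j] is the field acted upon, the column [k] the
    component of the result. *)
Lemma curvature_riemann v w x j k : smooth_metric_at x ->
  curvature conn v w x j k =
  \sum_a \sum_b v 0 a * w 0 b * riemann g k a b j x.
Proof.
move=> sm.
have subE (A B : 'M[R]_n) : (A - B) j k = A j k - B j k by rewrite !mxE.
have addE (A B : 'M[R]_n) : (A + B) j k = A j k + B j k by rewrite mxE.
rewrite /curvature subE addE subE !conn_derive// !conn_mul.
have swap (f : 'I_n -> 'I_n -> R) : \sum_a \sum_b w 0 a * v 0 b * f a b =
    \sum_a \sum_b v 0 a * w 0 b * f b a.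
  rewrite exchange_big; apply: eq_bigr => a _; apply: eq_bigr => b _.
  by rewrite [w 0 b * _]mulrC.
rewrite (swap (fun a b => partial a (christoffel g k b j) x)).
rewrite (swap (fun a b => \sum_m christoffel g k a m x * christoffel g m b j x)).
rewrite -sumrB -big_split -sumrB; apply: eq_bigr => a _ /=.
rewrite -sumrB -big_split -sumrB; apply: eq_bigr => b _ /=.
rewrite /riemann sumrB.
have alg (c p q r s : R) : c * p - c * q + c * r - c * s = c * (p - q + (r - s)).
  by ring.
exact: alg.
Qed.

Lemma curv_curvature u v w x : smooth_metric_at x ->
  curv g x u v w = w *m curvature conn u v x.
Proof.
have alg (p q r s : R) : p * q * r * s = s * (q * r * p) by ring.
move=> sm; apply/rowP => l; rewrite [LHS]mxE [RHS]mxE.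
under [RHS]eq_bigr do rewrite curvature_riemann// mulr_sumr.
rewrite [RHS]exchange_big; apply: eq_bigr => a _ /=.
under [RHS]eq_bigr do rewrite mulr_sumr.
rewrite [RHS]exchange_big; apply: eq_bigr => b _ /=.
by apply: eq_bigr => k _; rewrite alg.
Qed.

Lemma ricci_trace v x : smooth_metric_at x ->
  \sum_j \sum_k v 0 j * v 0 k * ricci g j k x =
  \sum_i (v *m curvature conn (delta_mx 0 i) v x) 0 i.
Proof.
move=> sm; under [RHS]eq_bigr do rewrite mxE.
rewrite exchange_big [RHS]exchange_big; apply: eq_bigr => k _ /=.
under eq_bigr do rewrite /ricci mulr_sumr.
rewrite exchange_big; apply: eq_bigr => i _ /=.
rewrite curvature_riemann// mulr_sumr [RHS](bigD1 i)//= [X in _ = _ + X]big1 ?addr0.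
  have alg (p q r : R) : p * q * r = q * (1 * p * r) by ring.
  by rewrite mulr_sumr; apply: eq_bigr => b _; rewrite mxE !eqxx alg.
move=> a ai; rewrite big1 ?mulr0// => b _.
by rewrite mxE eqxx (negPf ai) !mul0r.
Qed.

End Christoffel.

Lemma nabla_d_sff {R : realType} n m (g : 'rV[R]_n -> 'M[R]_n)
    (g' : 'rV[R]_m -> 'M[R]_m) (F : 'rV[R]_n -> 'rV[R]_m) i j x :
  nabla_d g g' F i j x = row j (sff F (dmap F) (conn g) (conn g') (delta_mx 0 i) x).
Proof.
have subE (A B : 'M[R]_(n, m)) a : (A - B) j a = A j a - B j a by rewrite !mxE.
have addE (A B : 'M[R]_(n, m)) a : (A + B) j a = A j a + B j a by rewrite mxE.
apply/rowP => a; rewrite [LHS]mxE [RHS]mxE /sff subE addE [RHS]addrAC.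
congr (_ - _ + _).
- rewrite mDij; congr ('D__ _ x); apply/funext => y; by rewrite mxE.
- rewrite [RHS]mxE; apply: eq_bigr => k _; rewrite !mxE; congr (_ * _).
  rewrite (bigD1 i)//= mxE !eqxx mul1r big1 ?addr0// => l li.
  by rewrite mxE eqxx (negPf li) mul0r.
- rewrite [RHS]mxE exchange_big; apply: eq_bigr => c _ /=.
  rewrite /Wpull !mxE mulr_sumr; apply: eq_bigr => b _.
  have alg (p q r : R) : p * q * r = r * (q * p) by ring.
  by rewrite -rowE !mxE alg.
Qed.

(** * Ricci curvature of minimal immersions *)

Section Orthonormal.
Context {R : realType}.

Definition posdef n (g : 'M[R]_n) := forall v : 'rV_n, v != 0 -> 0 < inner g v v.

Lemma inner_ge0 n (g : 'M[R]_n) v : posdef g -> 0 <= inner g v v.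
Proof.
move=> pg; have [->|v0] := eqVneq v 0; last exact/ltW/pg.
by rewrite /inner mul0mx mul0mx mxE.
Qed.

Lemma posdef_unit n (g : 'M[R]_n) : posdef g -> g \in unitmx.
Proof.
move=> pg; rewrite -row_free_unit -kermx_eq0; apply/eqP/row_matrixP => i.
rewrite row0; apply/eqP; apply: contraT => /pg.
by rewrite /inner -row_mul mulmx_ker row0 mul0mx mxE ltxx.
Qed.

(** Gram-Schmidt by induction on the dimension; the rows of [E] form the frame, and the Schur
    complement [S] is the metric on the orthogonal complement of the first basis vector. *)
Lemma orthonormal_frame n (g : 'M[R]_n) : g^T = g -> posdef g ->
  exists E : 'M[R]_n, E *m g *m E^T = 1%:M.
Proof.
elim: n g => [|n IH] g; first by exists 0; apply/matrixP => -[].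
rewrite -[n.+1]/(1 + n)%N in g * => sg pg.
pose a := g 0 0; pose b : 'rV[R]_n := ursubmx g; pose D : 'M[R]_n := drsubmx g.
have gE : g = block_mx a%:M b b^T D.
  rewrite -[LHS]submxK; congr block_mx.
    by rewrite [LHS]mx11_scalar !mxE; congr (g _ _)%:M; apply/val_inj.
  by rewrite /b trmx_ursub sg.
have a0 : 0 < a.
  have := pg (row_mx 1%:M 0); rewrite /inner gE tr_row_mx mul_row_block mul_row_col.
  rewrite !mul0mx trmx0 mulmx0 !addr0 trmx1 mulmx1 mul1mx mxE eqxx mulr1n; apply.
  apply/eqP => /(congr1 lsubmx); rewrite row_mxKl linear0 => /matrixP/(_ 0 0).
  by rewrite !mxE eqxx => /eqP; rewrite oner_eq0.
pose S := D - a^-1 *: (b^T *m b).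
have DS : D = S + a^-1 *: (b^T *m b) by rewrite subrK.
have sD : D^T = D by rewrite /D trmx_drsub sg.
have sS : S^T = S by rewrite linearB linearZ /= trmx_mul trmxK sD.
have an0 : a != 0 by rewrite gt_eqF.
(* These rows are orthogonal to the first basis vector, and [g] restricts to [S] on them. *)
have rowg k (w : 'M[R]_(k, n)) :
    row_mx (- a^-1 *: (w *m b^T)) w *m g = row_mx 0 (w *m S).
  rewrite gE mul_row_block mul_mx_scalar scalerA mulrN divff// scaleN1r addNr.
  congr row_mx; rewrite -scalemxAl scaleNr /S mulmxBr -scalemxAr mulmxA.
  by rewrite addrC.
have pS : posdef S.
  move=> w w0.
  have : row_mx (- a^-1 *: (w *m b^T)) w != 0 :> 'rV_(1 + n).
    by apply: contra w0 => /eqP/(congr1 rsubmx); rewrite row_mxKr linear0 => ->.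
  move=> /pg; rewrite /inner rowg tr_row_mx mul_row_col mul0mx add0r.
  exact.
have [E' HE'] := IH S sS pS.
pose r := (Num.sqrt a)^-1.
have ra : r * a * r = 1.
  rewrite /r mulrAC -invfM -expr2 sqr_sqrtr ?ltW// mulVf//.
(* The normalized first basis vector, then the frame of [S] lifted to its orthogonal complement. *)
exists (col_mx (row_mx r%:M 0) (row_mx (- a^-1 *: (E' *m b^T)) E')).
rewrite mul_col_mx rowg gE mul_row_block !mul0mx !addr0 mul_scalar_mx mul_scalar_mx.
rewrite tr_col_mx mul_col_row !tr_row_mx !mul_row_col trmx0 !mulmx0 !mul0mx addr0 !add0r.
rewrite HE' tr_scalar_mx scale_scalar_mx mul_scalar_mx scale_scalar_mx ra.
rewrite linearZ /= trmx_mul trmxK -scalemxAr -!scalemxAl.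
rewrite mul_scalar_mx scalerA mulNr [r * a]mulrC mulKf// scaleNr addNr.
by rewrite -scalar_mx_block.
Qed.

(** Turns contractions with the inverse metric into sums over the frame. *)
Lemma frame_inv n (g E : 'M[R]_n) : E *m g *m E^T = 1%:M -> invmx g = E^T *m E.
Proof.
move=> E1; have E2 : g *m (E^T *m E) = 1%:M.
  by rewrite mulmxA; apply: mulmx1C; rewrite mulmxA.
have [ug _] := mulmx1_unit E2.
by rewrite -[RHS]mul1mx -(mulVmx ug) -mulmxA E2 mulmx1.
Qed.

End Orthonormal.

(** * The Gauss equation traced over an orthonormal frame *)

Section RicciBound.
Context {R : realType} {n m : nat} (U : set 'rV[R]_n) (oU : open U).
Variables (F : 'rV[R]_n -> 'rV[R]_m).
Variables (g : 'rV[R]_n -> 'M[R]_n) (G : 'rV[R]_m -> 'M[R]_m).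
Hypothesis sF : forall a, smooth_on U (Defs.comp F a).
Hypothesis smg : forall x, U x -> smooth_metric_at g x.
Hypothesis smG : forall x, U x -> smooth_metric_at G (F x).
Hypothesis gF : forall x, U x -> g x = pullback F G x.

Let C := conn g.
Let W := conn G.
Let J := dmap F.
Let II := sff F J C W.

Let lcg x (Ux : U x) : levi_civita g C x := conn_levi_civita (smg Ux).
Let lcG x (Ux : U x) : levi_civita G W (F x) := conn_levi_civita (smG Ux).
Let symJ x v w (Ux : U x) : w *m mD v J x = v *m mD w J x :=
  mD_dmap_sym oU sF v w Ux.

Lemma immersion_sff_sym x v w : U x -> w *m II v x = v *m II w x.
Proof. exact: (sff_sym symJ lcg lcG). Qed.

Lemma immersion_sff_normal x v : U x -> II v x *m G (F x) *m (J x)^T = 0.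
Proof.
exact: (sff_normal oU (smooth_map_mdiff oU sF) (smooth_map_mD oU sF)
  (dmap_mdiff oU sF) symJ lcg lcG gF).
Qed.

Lemma immersion_gauss x v w : U x ->
  curvature C v w x *m g x =
    J x *m curvature W (v *m J x) (w *m J x) (F x) *m G (F x) *m (J x)^T
    + II w x *m G (F x) *m (II v x)^T - II v x *m G (F x) *m (II w x)^T.
Proof.
exact: (gauss oU (smooth_map_mdiff oU sF) (smooth_map_mD oU sF)
  (dmap_mdiff oU sF) (mD_dmap_mdiff oU sF) symJ (mD_dmap_schwarz oU sF) lcg lcG
  (@conn_linearE R m G) gF).
Qed.

Lemma sff_sum x v w :  U x ->
  w *m II v x = \sum_i \sum_j w 0 i * v 0 j *: nabla_d g G F j i x.
Proof.
move=> Ux; rewrite {1}[w]row_sum_delta mulmx_suml; apply: eq_bigr => i _.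
rewrite -scalemxAl immersion_sff_sym// {1}[v]row_sum_delta mulmx_suml scaler_sumr.
apply: eq_bigr => j _.
by rewrite -scalemxAl scalerA immersion_sff_sym// nabla_d_sff rowE.
Qed.

Lemma frame_contract (E : 'M[R]_n) (T : 'I_n -> 'I_n -> 'rV[R]_m) :
  \sum_i \sum_j (E^T *m E) i j *: T i j =
  \sum_a \sum_j \sum_i E a j * E a i *: T i j.
Proof.
rewrite exchange_big [RHS]exchange_big; apply: eq_bigr => j _ /=.
rewrite [RHS]exchange_big; apply: eq_bigr => i _ /=.
rewrite mxE scaler_suml; apply: eq_bigr => a _.
by rewrite !mxE mulrC.
Qed.

Lemma tension_frame x (E : 'M[R]_n) : U x -> E *m g x *m E^T = 1%:M ->
  tension g G F x = \sum_a row a E *m II (row a E) x.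
Proof.
move=> Ux /frame_inv gE.
rewrite /tension gE frame_contract; apply: eq_bigr => a _.
rewrite sff_sum//; apply: eq_bigr => j _; apply: eq_bigr => i _.
by rewrite !mxE.
Qed.

Lemma tension_normal x : U x -> posdef (g x) ->
  tension g G F x *m G (F x) *m (J x)^T = 0.
Proof.
move=> Ux pg; have [E E1] := orthonormal_frame (lc_sym (conn_levi_civita (smg Ux))) pg.
rewrite (tension_frame Ux E1) !mulmx_suml big1// => a _.
by rewrite -!mulmxA [II _ _ *m _]mulmxA immersion_sff_normal// mulmx0.
Qed.

Lemma mean_curvature_tension x nu : U x ->
  mean_curvature g G F x nu = inner (G (F x)) (tension g G F x) nu / n%:R.
Proof.
move=> Ux; congr (_ / _); rewrite /mxtrace /inner /tension !mulmx_suml summxE.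
apply: eq_bigr => i _; rewrite mxE !mulmx_suml summxE; apply: eq_bigr => j _.
rewrite -!scalemxAl [RHS]mxE mulrC; congr (_ * _); last by rewrite mxE.
by rewrite -[in LHS](inv_sym (smg Ux)) mxE.
Qed.

(* If the tension field, which is [n] times the mean curvature vector, were
   nonzero, its normalization would be a unit normal with nonzero mean
   curvature. *)
Lemma minimal_tension0 x : (0 < n)%N -> U x -> posdef (g x) -> posdef (G (F x)) ->
  (forall nu, unit_normal G F x nu -> mean_curvature g G F x nu = 0) ->
  tension g G F x = 0.
Proof.
move=> n0 Ux pg pG Hmin; apply/eqP; apply: contraT => H0.
set H := tension g G F x in H0; have Hpos := pG _ H0.
pose c := (Num.sqrt (inner (G (F x)) H H))^-1.
have c0 : c != 0 by rewrite invr_neq0// gt_eqF// sqrtr_gt0.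
have innZ : inner (G (F x)) H (c *: H) = c * inner (G (F x)) H H.
  by rewrite /inner linearZ /= -scalemxAr mxE.
have : unit_normal G F x (c *: H).
  split.
    have -> : inner (G (F x)) (c *: H) (c *: H) = c * (c * inner (G (F x)) H H).
      by rewrite -innZ /inner -!scalemxAl mxE.
    by rewrite mulrA /c -expr2 exprVn sqr_sqrtr ?ltW// mulVf// gt_eqF.
  move=> v; have := tension_normal Ux pg; rewrite -/H => N0.
  rewrite /inner form_tr (lc_sym (conn_levi_civita (smG Ux))) trmx_mul mulmxA.
  by rewrite -!scalemxAl N0 mul0mx scaler0 mxE.
move=> /Hmin; rewrite mean_curvature_tension// -/H innZ => /eqP.
have -> // : (c * inner (G (F x)) H H / n%:R == 0) = false.
apply/negbTE; rewrite mulf_neq0//; last by rewrite invr_neq0// pnatr_eq0 -lt0n.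
by rewrite mulf_neq0// gt_eqF.
Qed.

Lemma curvature_linear_l u w x : smooth_metric_at g x ->
  curvature C u w x = \sum_i u 0 i *: curvature C (delta_mx 0 i) w x.
Proof.
move=> sm; apply/matrixP => j k; rewrite summxE curvature_riemann//.
apply: eq_bigr => a _; rewrite mxE curvature_riemann//.
rewrite [X in _ = _ * X](bigD1 a)//=.
rewrite [X in _ = _ * (_ + X)]big1 ?addr0 => [|b ba].
  by rewrite mulr_sumr; apply: eq_bigr => b _; rewrite mxE !eqxx mul1r mulrA.
by rewrite big1// => d _; rewrite mxE eqxx (negPf ba) !mul0r.
Qed.

Lemma ricci_nonpos x (v : 'rV[R]_n) : U x -> posdef (g x) -> posdef (G (F x)) ->
  tension g G F x = 0 ->
  (forall X Y : 'rV[R]_m,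
     (Y *m curvature W X Y (F x) *m G (F x) *m X^T) 0 0 <= 0) ->
  \sum_j \sum_k v 0 j * v 0 k * ricci g j k x <= 0.
Proof.
move=> Ux pg pG H0 sec; have sm := smg Ux.
have [E E1] := orthonormal_frame (lc_sym (conn_levi_civita sm)) pg.
have H0' := tension_frame Ux E1; rewrite H0 in H0'.
rewrite ricci_trace//.
(* Matrix of the operator sending [u] to [R(u, v) v]; its trace is [Ric(v, v)], computed over the
   orthonormal frame instead of the coordinate basis. *)
pose K : 'M[R]_n := \matrix_i (v *m curvature C (delta_mx 0 i) v x).
have rK (u : 'rV_n) : u *m K = v *m curvature C u v x.
  rewrite curvature_linear_l// mulmx_sumr; apply/rowP => k.
  rewrite mxE summxE; apply: eq_bigr => i _.
  by rewrite -scalemxAr [RHS]mxE [K _ _]mxE.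
have -> : \sum_i (v *m curvature C (delta_mx 0 i) v x) 0 i = \tr K.
  by apply: eq_bigr => i _; rewrite [RHS]mxE.
have -> : \tr K = \sum_a (row a E *m K *m g x *m (row a E)^T) 0 0.
  have -> : \tr K = \tr (E *m K *m g x *m E^T).
    rewrite -!mulmxA mxtrace_mulC -!mulmxA.
    have -> : g x *m (E^T *m E) = 1%:M.
      by rewrite -(frame_inv E1) mulmxV// posdef_unit.
    by rewrite mulmx1.
  apply: eq_bigr => a _.
  rewrite -2!row_mul; move: (E *m K *m g x) => A.
  by rewrite [LHS]mxE [RHS]mxE; apply: eq_bigr => j _; rewrite !mxE.
(* The Gauss equation for [e_a, v], without the ambient curvature and [- |II(e_a, v)|^2], which are
   both nonpositive. *)
have key a : (row a E *m K *m g x *m (row a E)^T) 0 0 <=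
    inner (G (F x)) (v *m II v x) (row a E *m II (row a E) x).
  set u := row a E; rewrite rK -(mulmxA v) immersion_gauss//.
  have split (A B D : 'M[R]_n) : v *m (A + B - D) *m u^T =
      v *m A *m u^T + v *m B *m u^T - v *m D *m u^T.
    by rewrite mulmxBr mulmxDr mulmxBl mulmxDl.
  rewrite split.
  have -> : v *m (J x *m curvature W (u *m J x) (v *m J x) (F x) *m G (F x)
      *m (J x)^T) *m u^T = (v *m J x) *m curvature W (u *m J x) (v *m J x) (F x)
      *m G (F x) *m (u *m J x)^T by rewrite trmx_mul !mulmxA.
  have -> : v *m (II v x *m G (F x) *m (II u x)^T) *m u^T =
      (v *m II v x) *m G (F x) *m (u *m II u x)^T by rewrite trmx_mul !mulmxA.
  have -> : v *m (II u x *m G (F x) *m (II v x)^T) *m u^T =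
      (v *m II u x) *m G (F x) *m (v *m II u x)^T.
    transitivity ((v *m II u x) *m G (F x) *m (u *m II v x)^T).
      by rewrite trmx_mul !mulmxA.
    by rewrite (immersion_sff_sym u v Ux).
  have S1 := sec (u *m J x) (v *m J x).
  have S2 := inner_ge0 (v *m II u x) pG; rewrite /inner in S2 *.
  move: S1 S2; move: (_ *m _ *m _) (_ *m _ *m _) (_ *m _ *m _).
  by move=> A B D; rewrite !mxE; lra.
apply: le_trans (ler_sum _ (fun a _ => key a)) _.
(* Summed over the frame, the bounds give the pairing of [II(v, v)] with the tension field, which is
   zero. *)
rewrite /inner -summxE -mulmx_sumr -linear_sum /= -H0' linear0 mulmx0 mxE.
by [].
Qed.

End RicciBound.

(** * Curvature of warped products *)

Section BlockCalculus.
Context {R : realType} {V : normedModType R}.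
Implicit Types (x v : V).

Lemma mdiff_block n1 n2 m1 m2 (A : V -> 'M[R]_(n1, m1)) (B : V -> 'M[R]_(n1, m2))
    (C : V -> 'M[R]_(n2, m1)) (D : V -> 'M[R]_(n2, m2)) x :
  mdiff A x -> mdiff B x -> mdiff C x -> mdiff D x ->
  mdiff (fun y => block_mx (A y) (B y) (C y) (D y)) x.
Proof.
move=> dA dB dC dD i j; rewrite /block_mx; under eq_fun do rewrite mxE.
by case: (fintype.split i) => i'; under eq_fun do rewrite mxE; case: (fintype.split j) => j'.
Qed.

Lemma mD_block n1 n2 m1 m2 (A : V -> 'M[R]_(n1, m1)) (B : V -> 'M[R]_(n1, m2))
    (C : V -> 'M[R]_(n2, m1)) (D : V -> 'M[R]_(n2, m2)) x v :
  mD v (fun y => block_mx (A y) (B y) (C y) (D y)) x =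
  block_mx (mD v A x) (mD v B x) (mD v C x) (mD v D x).
Proof.
apply/matrixP => i j; rewrite mDij /block_mx [RHS]mxE.
under eq_fun do rewrite mxE.
by case: (fintype.split i) => i'; under eq_fun do rewrite mxE; rewrite [RHS]mxE;
  case: (fintype.split j) => j'; rewrite mDij.
Qed.

Lemma mdiff_scalar n (c : V -> R) x : differentiable c x ->
  mdiff (fun y => (c y)%:M : 'M[R]_n) x.
Proof.
move=> dc i j; under eq_fun do rewrite mxE.
by case: (i == j) => //=; exact: differentiable_cst.
Qed.

Lemma mD_scalar n (c : V -> R) x v :
  mD v (fun y => (c y)%:M : 'M[R]_n) x = ('D_v c x)%:M.
Proof.
apply/matrixP => i j; rewrite mDij mxE; under eq_fun do rewrite mxE.
by case: (i == j) => //=; rewrite ?mulr0n derive_cst.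
Qed.

End BlockCalculus.

Section Coordinates.
Context {R : realType} {n : nat}.
Implicit Types (y X : 'rV[R]_(1 + n)) (f : R -> R).

Lemma mdiff_id y : mdiff (fun z : 'rV[R]_(1 + n) => z) y.
Proof. by move=> i j; exact: differentiable_coord. Qed.

Lemma mD_id y X : mD X (fun z : 'rV[R]_(1 + n) => z) y = X.
Proof. by rewrite mDE ?derive_id//; exact: mdiff_id. Qed.

Lemma mdiff_rsub y : mdiff (fun z : 'rV[R]_(1 + n) => rsubmx z) y.
Proof. by move=> i j; under eq_fun do rewrite mxE; exact: differentiable_coord. Qed.

Lemma mD_rsub y X : mD X (fun z : 'rV[R]_(1 + n) => rsubmx z) y = rsubmx X.
Proof.
apply/matrixP => i j; rewrite mDij [RHS]mxE.
under eq_fun do rewrite mxE.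
by rewrite -[in RHS](mD_id y X) mDij.
Qed.

Lemma coord0_differentiable f y : derivable f (y 0 0) 1 ->
  differentiable (fun z : 'rV[R]_(1 + n) => f (z 0 0)) y.
Proof.
move=> /derivable1_diffP df.
by apply: (@differentiable_comp _ _ _ _ (fun z : 'rV[R]_(1 + n) => z 0 0) f);
  [exact: differentiable_coord|].
Qed.

Lemma coord0_derive f y X : derivable f (y 0 0) 1 ->
  'D_X (fun z : 'rV[R]_(1 + n) => f (z 0 0)) y = X 0 0 * derive1 f (y 0 0).
Proof.
move=> df; have df' := (derivable1_diffP _ _).1 df.
have dc : differentiable (fun z : 'rV[R]_(1 + n) => z 0 0) y.
  exact: differentiable_coord.
rewrite deriveE; last exact: coord0_differentiable.
rewrite (diff_comp dc df')/= diff1E// -deriveE//.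
by have := mD_id y X; move=> /matrixP/(_ 0 0); rewrite mDij => ->.
Qed.

End Coordinates.

Lemma smooth_metric {R : realType} {n : nat} (U : set 'rV[R]_n)
    (g : 'rV[R]_n -> 'M[R]_n) x : open U ->
  (forall i j, smooth_on U (fun y => g y i j)) ->
  (forall y, U y -> (g y)^T = g y) -> (forall y, U y -> posdef (g y)) ->
  U x -> smooth_metric_at g x.
Proof.
move=> oU sg symg pg Ux; split.
- by apply: filterS (open_near oU Ux) => y; exact: symg.
- by apply: filterS (open_near oU Ux) => y Uy; exact/posdef_unit/pg.
- apply: filterS (open_near oU Ux) => y Uy i j.
  exact: smooth_differentiable (sg i j) Uy.
- move=> i j k; exact: smooth_differentiable (smooth_partial i (sg j k)) Ux.
Qed.

(** Here [(a, x)] and [(b, v)] are the two directions, [p = f' / f], [q = f f'], and [k], [l], [s]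
    are [f'' / f], [f f''], [f'^2]. The derivatives of the metric are eliminated by metric
    compatibility on the fiber. *)
Lemma warped_curvature_algebra {R : realType} n (a b p q p' q' k l s : R)
    (x v : 'rV[R]_n) (g Cx Cv dxg dvg dxCv dvCx : 'M[R]_n) :
  g^T = g -> dxg = Cx *m g + (Cx *m g)^T -> dvg = Cv *m g + (Cv *m g)^T ->
  v *m Cx = x *m Cv -> p' + p ^+ 2 = k -> q' - p * q = l -> p * q = s ->
  let Wx := block_mx 0 (p *: x) (- q *: (g *m x^T)) (Cx + (a * p)%:M) in
  let Wv := block_mx 0 (p *: v) (- q *: (g *m v^T)) (Cv + (b * p)%:M) in
  block_mx 0 ((a * p') *: v)
    (- (a * q') *: (g *m v^T) - q *: (dxg *m v^T)) (dxCv + (b * (a * p'))%:M) -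
  block_mx 0 ((b * p') *: x)
    (- (b * q') *: (g *m x^T) - q *: (dvg *m x^T)) (dvCx + (a * (b * p'))%:M)
  + Wv *m Wx - Wx *m Wv =
  block_mx 0 (k *: (a *: v - b *: x)) (- l *: (g *m (a *: v - b *: x)^T))
    (dxCv - dvCx + Cv *m Cx - Cx *m Cv - s *: (g *m (v^T *m x - x^T *m v)))
  :> 'M[R]_(1 + n).
Proof.
move=> sg -> -> vC <- <- <- /=; rewrite !mulmx_block.
rewrite !opp_block_mx !add_block_mx !mul0mx !mulmx0 !add0r ?oppr0 ?addr0.
have gvx : v *m (g *m x^T) = x *m (g *m v^T).
  by apply/matrixP => i j; rewrite !mulmxA !ord1 form_tr sg.
congr block_mx.
- by rewrite -!scalemxAl -!scalemxAr gvx add0r addrN.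
- rewrite -!scalemxAl !mulmxDr vC !mul_mx_scalar.
  by move: (x *m Cv) => A; apply/matrixP => i j; rewrite !mxE; ring.
- have E1 : (Cx *m g)^T *m v^T = g *m (x *m Cv)^T.
    by rewrite trmx_mul sg -vC trmx_mul mulmxA.
  have E2 : (Cv *m g)^T *m x^T = g *m (x *m Cv)^T.
    by rewrite trmx_mul sg trmx_mul mulmxA.
  rewrite !mulmxDl E1 E2 !mul_scalar_mx -!scalemxAr !mulmxA.
  have -> : (a *: v - b *: x)^T = a *: v^T - b *: x^T.
    by apply/matrixP => i j; rewrite !mxE.
  rewrite mulmxBr -!scalemxAr.
  move: (Cx *m g *m v^T) (Cv *m g *m x^T) (g *m v^T) (g *m x^T) (g *m _) => A B C D E.
  by apply/matrixP => i j; rewrite !mxE; ring.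
- rewrite -!scalemxAl -!scalemxAr !(mulmxDl, mulmxDr) !mul_scalar_mx !mul_mx_scalar.
  rewrite mulmxN !mulmxA.
  move: (g *m v^T *m x) (g *m x^T *m v) (Cv *m Cx) (Cx *m Cv) => A B C D.
  apply/matrixP => i j; rewrite !mxE; case: (i == j) => /=; ring.
Qed.

Section Inner.
Context {R : realType} {n : nat} (g : 'M[R]_n).
Implicit Types (u v w : 'rV[R]_n).

Lemma innerDl u v w : inner g (u + v) w = inner g u w + inner g v w.
Proof. by rewrite /inner !mulmxDl mxE. Qed.

Lemma innerZl (c : R) v w : inner g (c *: v) w = c * inner g v w.
Proof. by rewrite /inner -!scalemxAl mxE. Qed.

Lemma innerBl u v w : inner g (u - v) w = inner g u w - inner g v w.
Proof. by rewrite innerDl -scaleN1r innerZl mulN1r. Qed.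

Lemma inner_sym v w : g^T = g -> inner g v w = inner g w v.
Proof. by move=> sg; rewrite /inner form_tr sg. Qed.

End Inner.

Section FirstCoordinate.
Context {R : realType} {n : nat}.

Lemma row0_scalar (X : 'rV[R]_(1 + n)) : lsubmx X = (X 0 0)%:M.
Proof. by rewrite [LHS]mx11_scalar mxE; congr (X _ _)%:M; exact: val_inj. Qed.

Lemma row_mx00 (c : 'M[R]_1) (x : 'rV[R]_n) : row_mx c x 0 0 = c 0 0.
Proof. by rewrite -[RHS](row_mxEl c x); congr (row_mx _ _ _ _); exact: val_inj. Qed.

End FirstCoordinate.

(** * Connection and curvature of the warped metric *)

Section Warped.
Context {R : realType} {n : nat} (I : set R) (D : set 'rV[R]_n).
Variables (f : R -> R) (g : 'rV[R]_n -> 'M[R]_n).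
Hypothesis oI : open I.
Hypothesis oD : open D.
Hypothesis sf : forall k t, I t -> derivable (derive1n k f) t 1.
Hypothesis f0 : forall t, I t -> 0 < f t.
Hypothesis sg : forall i j, smooth_on D (fun y => g y i j).
Hypothesis symg : forall y, D y -> (g y)^T = g y.
Hypothesis pg : forall y, D y -> posdef (g y).
Implicit Types (X Y y : 'rV[R]_(1 + n)) (t : R).

Let smg z (Dz : D z) : smooth_metric_at g z := smooth_metric oD sg symg pg Dz.

Definition warped_domain : set 'rV[R]_(1 + n) :=
  [set y : 'rV[R]_(1 + n) | I (y 0 0) /\ D (rsubmx y)].

Definition warped_metric (y : 'rV[R]_(1 + n)) : 'M[R]_(1 + n) :=
  block_mx 1%:M 0 0 (f (y 0 0) ^+ 2 *: g (rsubmx y)).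

Let f1 : R -> R := derive1 f.
Let f2 : R -> R := derive1 (derive1 f).
(** The logarithmic derivative of [f] and half the derivative of [f^2]: the two functions through
    which the warping enters the connection. *)
Let phi t : R := f1 t / f t.
Let q t := f t * f1 t.

Let df t (It : I t) : derivable f t 1 := @sf 0%N t It.
Let df1 t (It : I t) : derivable f1 t 1 := @sf 1%N t It.
Let fn0 t (It : I t) : f t != 0 := lt0r_neq0 (f0 It).

Lemma open_warped_domain : open warped_domain.
Proof.
have -> : warped_domain = (fun y : 'rV[R]_(1 + n) => y 0 0) @^-1` I `&`
  (fun y : 'rV[R]_(1 + n) => rsubmx y) @^-1` D by [].
apply: openI; apply: open_comp => // y _.
  exact/differentiable_continuous/differentiable_coord.
exact: continuous_rsubmx.
Qed.

Lemma derivable_phi t : I t -> derivable phi t 1.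
Proof.
move=> It; apply: derivableM; first exact: df1.
by apply: derivableV; [exact: fn0|exact: df].
Qed.

Lemma derivable_q t : I t -> derivable q t 1.
Proof. by move=> It; apply: derivableM; [exact: df|exact: df1]. Qed.

Lemma derive_q t : I t -> derive1 q t = f1 t ^+ 2 + f t * f2 t.
Proof.
move=> It; rewrite derive1E (@deriveM _ _ f f1); [|exact: df|exact: df1].
by rewrite -!derive1E /GRing.scale /= -/f1 -/f2; ring.
Qed.

Lemma derive_phi t : I t -> derive1 phi t = f2 t / f t - phi t ^+ 2.
Proof.
move=> It; rewrite derive1E (@deriveM _ _ f1 (fun s => (f s)^-1)); first last.
- by apply: derivableV; [exact: fn0|exact: df].
- exact: df1.
rewrite deriveV; [|exact: fn0|exact: df].
rewrite -!derive1E /GRing.scale /= -/f1 -/f2 /phi.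
by have := fn0 It; move: (f t) (f1 t) (f2 t) => a b c a0; field.
Qed.

Lemma derivable_sqr t : I t -> derivable (fun s => f s ^+ 2) t 1.
Proof.
move=> It; have -> : (fun s => f s ^+ 2) = f * f by apply/funext => s; exact: expr2.
by apply: derivableM; exact: df.
Qed.

Lemma derive_sqr t : I t -> derive1 (fun s => f s ^+ 2) t = 2 * q t.
Proof.
move=> It; have -> : (fun s => f s ^+ 2) = f * f by apply/funext => s; exact: expr2.
rewrite derive1E deriveM; [|exact: df|exact: df].
by rewrite -!derive1E /GRing.scale /= -/f1 /q; ring.
Qed.

Lemma mdiff_g_rsub y : D (rsubmx y) -> mdiff (fun z => g (rsubmx z)) y.
Proof.
move=> Dy; apply: mdiff_chain; first exact: mdiff_rsub.
exact: (nbhs_singleton (sm_diff (smg Dy))).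
Qed.

Lemma mD_g_rsub y X : D (rsubmx y) ->
  mD X (fun z => g (rsubmx z)) y = mD (rsubmx X) g (rsubmx y).
Proof.
move=> Dy; rewrite mD_chain ?mD_rsub//; first exact: mdiff_rsub.
exact: (nbhs_singleton (sm_diff (smg Dy))).
Qed.

Lemma mdiff_Dg_rsub y (x : 'rV[R]_n) : D (rsubmx y) ->
  mdiff (fun z : 'rV[R]_(1 + n) => mD x g (rsubmx z)) y.
Proof.
move=> Dy; apply: (@mdiff_chain _ _ _ _ _ _ (fun z : 'rV[R]_n => mD x g z)).
  exact: mdiff_rsub.
move=> i j; under eq_fun do rewrite mDij.
exact: (smooth_derive_differentiable oD x (sg i j) Dy).
Qed.

Lemma warped_metric_mdiff y : warped_domain y -> mdiff warped_metric y.
Proof.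
move=> [Iy Dy]; apply: mdiff_block; try exact: mdiff_cst.
apply: mdiffZ; last exact: mdiff_g_rsub.
exact: (coord0_differentiable (derivable_sqr Iy)).
Qed.

Lemma warped_metric_mD y X : warped_domain y ->
  mD X warped_metric y = block_mx 0 0 0
    ((2 * X 0 0 * q (y 0 0)) *: g (rsubmx y)
     + f (y 0 0) ^+ 2 *: mD (rsubmx X) g (rsubmx y)).
Proof.
move=> [Iy Dy]; rewrite /warped_metric mD_block !mD_cst.
have dsq := derivable_sqr Iy.
rewrite mD_Z; [|exact: coord0_differentiable dsq|exact: mdiff_g_rsub].
rewrite (mD_g_rsub X Dy) (coord0_derive X dsq) derive_sqr//.
by congr (block_mx _ _ _ (_ *: _ + _)); ring.
Qed.

Lemma warped_metric_sym y : warped_domain y -> (warped_metric y)^T = warped_metric y.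
Proof.
by move=> [_ Dy]; rewrite tr_block_mx trmx1 !trmx0 linearZ /= symg.
Qed.

Lemma warped_inner y X Y : inner (warped_metric y) X Y =
  X 0 0 * Y 0 0 + f (y 0 0) ^+ 2 * inner (g (rsubmx y)) (rsubmx X) (rsubmx Y).
Proof.
rewrite /inner -{1}[X]hsubmxK -{1}[Y]hsubmxK /warped_metric.
rewrite mul_row_block !mulmx0 addr0 add0r mulmx1 tr_row_mx mul_row_col mxE.
rewrite -!scalemxAr -!scalemxAl [X in _ + X]mxE; congr (_ + _).
rewrite mxE big_ord1 !mxE; congr (X _ _ * Y _ _); exact: val_inj.
Qed.

Lemma row0_rsub X : X 0 0 = 0 -> rsubmx X = 0 -> X = 0.
Proof.
move=> X0 r0; rewrite -[X]hsubmxK r0.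
have -> : lsubmx X = 0.
  apply/rowP => i; rewrite !mxE -X0; congr (X _ _).
  by apply: val_inj; rewrite /= ord1.
exact: row_mx0.
Qed.

Lemma warped_metric_posdef y : warped_domain y -> posdef (warped_metric y).
Proof.
move=> [Iy Dy] X X0; rewrite warped_inner.
have f2_gt0 : 0 < f (y 0 0) ^+ 2 by rewrite exprn_gt0// f0.
have [r0|r0] := eqVneq (rsubmx X) 0.
  have X00 : X 0 0 != 0 by apply: contraNneq X0 => X00; apply/eqP/row0_rsub.
  by rewrite r0 /inner mul0mx mul0mx mxE mulr0 addr0 -expr2 exprn_even_gt0.
apply: ltr_wpDl; first by rewrite -expr2 sqr_ge0.
by rewrite mulr_gt0//; apply: pg.
Qed.

Lemma warped_smooth_metric y : warped_domain y -> smooth_metric_at warped_metric y.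
Proof.
move=> Vy; have nV := open_near open_warped_domain Vy; split.
- by apply: filterS nV => z; exact: warped_metric_sym.
- by apply: filterS nV => z Vz; exact/posdef_unit/warped_metric_posdef.
- by apply: filterS nV => z; exact: warped_metric_mdiff.
- move=> i j k; pose X : 'rV[R]_(1 + n) := delta_mx 0 i.
  (* Second derivatives are reached through the explicit first derivative, which is valid near [y]
     and visibly differentiable. *)
  suff /(_ j k) : mdiff (mD X warped_metric) y by under eq_fun do rewrite mDij.
  apply: (@near_mdiff _ _ _ _ (fun z : 'rV[R]_(1 + n) => block_mx 0 0 0
    ((2 * X 0 0 * q (z 0 0)) *: g (rsubmx z)
     + f (z 0 0) ^+ 2 *: mD (rsubmx X) g (rsubmx z)))).
    by apply: filterS nV => z Vz; rewrite -warped_metric_mD.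
  case: Vy => Iy Dy; apply: mdiff_block; try exact: mdiff_cst.
  apply: mdiffD; apply: mdiffZ.
  + apply: differentiableM; first exact: differentiable_cst.
    exact/coord0_differentiable/derivable_q.
  + exact: mdiff_g_rsub.
  + exact: (coord0_differentiable (derivable_sqr Iy)).
  + exact: mdiff_Dg_rsub.
Qed.

(** With [X = (a, x)], the first row says [D_X d_t = (f'/f) x]. The second row says that a field [V]
    constant along the fiber has derivative [V *m conn g x + a (f'/f) V - f f' <x, V> d_t]. *)
Definition warped_conn (X y : 'rV[R]_(1 + n)) : 'M[R]_(1 + n) :=
  block_mx 0 (phi (y 0 0) *: rsubmx X)
    (- q (y 0 0) *: (g (rsubmx y) *m (rsubmx X)^T))
    (conn g (rsubmx X) (rsubmx y) + (X 0 0 * phi (y 0 0))%:M).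

(** The candidate is checked to be torsion-free and metric; uniqueness replaces the computation of
    the Christoffel symbols. *)
Lemma warped_connE X y : warped_domain y ->
  warped_conn X y = conn warped_metric X y.
Proof.
move=> Vy; have [Iy Dy] := Vy; have lc := conn_levi_civita (smg Dy).
have sgy := symg Dy.
apply: (levi_civita_unique (C := warped_conn ^~ y)); first exact: warped_smooth_metric.
- move=> {}X Y; rewrite -{1}[Y]hsubmxK -{2}[X]hsubmxK !mul_row_block.
  rewrite !mulmx0 !add0r -!scalemxAr; congr (row_mx (_ *: _) _).
    by rewrite !mulmxA; apply/matrixP => i j; rewrite !ord1 form_tr sgy.
  rewrite !mulmxDr (lc_torsion lc (rsubmx X)) !mul_mx_scalar.
  have l0 Z : lsubmx Z = (Z 0 0)%:M :> 'M[R]_1.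
    rewrite [LHS]mx11_scalar mxE; congr (Z _ _)%:M; exact: val_inj.
  rewrite !l0 !mul_scalar_mx !scalerA.
  rewrite [LHS]addrCA [RHS]addrCA; congr (_ + _).
  by rewrite addrC ![phi _ * _]mulrC.
- move=> {}X; rewrite warped_metric_mD// mulmx_block.
  rewrite !mulmx0 !mul0mx !mulmx1 !addr0 !add0r tr_block_mx add_block_mx !trmx0 addr0.
  rewrite (lc_metric lc).
  have phiq : f (y 0 0) ^+ 2 * phi (y 0 0) = q (y 0 0).
    by rewrite /phi /q; have := fn0 Iy; move: (f _) (f1 _) => c e c0; field.
  have UR : phi (y 0 0) *: rsubmx X *m (f (y 0 0) ^+ 2 *: g (rsubmx y)) +
      (- q (y 0 0) *: (g (rsubmx y) *m (rsubmx X)^T))^T = 0.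
    rewrite -scalemxAr -scalemxAl scalerA phiq linearZ /= trmx_mul trmxK sgy.
    by rewrite scaleNr addrN.
  have LL : - q (y 0 0) *: (g (rsubmx y) *m (rsubmx X)^T) +
      (phi (y 0 0) *: rsubmx X *m (f (y 0 0) ^+ 2 *: g (rsubmx y)))^T = 0.
    by apply: trmx_inj; rewrite linearD /= trmxK addrC UR trmx0.
  rewrite UR LL; congr block_mx.
  rewrite -scalemxAr mulmxDl mul_scalar_mx -phiq.
  move: (conn g _ _ *m _) (f _) (phi _) => A c e.
  apply/matrixP => i j; rewrite !mxE.
  have -> : g (rsubmx y) j i = g (rsubmx y) i j by rewrite -{1}sgy mxE.
  by ring.
Qed.

Lemma mD_warped_conn X Y y : warped_domain y ->
  mD X (warped_conn Y) y =
  block_mx 0 ((X 0 0 * derive1 phi (y 0 0)) *: rsubmx Y)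
    (- (X 0 0 * derive1 q (y 0 0)) *: (g (rsubmx y) *m (rsubmx Y)^T)
     - q (y 0 0) *: (mD (rsubmx X) g (rsubmx y) *m (rsubmx Y)^T))
    (mD (rsubmx X) (conn g (rsubmx Y)) (rsubmx y)
     + (Y 0 0 * (X 0 0 * derive1 phi (y 0 0)))%:M).
Proof.
move=> [Iy Dy].
have dphi := coord0_differentiable (derivable_phi Iy).
have dq := coord0_differentiable (derivable_q Iy).
have dgr := mdiff_g_rsub Dy.
have dc := mdiff_chain (mdiff_rsub y) (conn_mdiff (rsubmx Y) (smg Dy)).
rewrite /warped_conn mD_block mD_cst; congr block_mx.
- rewrite mD_Z; [|exact: dphi|exact: mdiff_cst].
  by rewrite mD_cst scaler0 addr0 (coord0_derive X (derivable_phi Iy)).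
- rewrite mD_Z; first last.
  + by apply: mdiffM => //; exact: mdiff_cst.
  + exact: differentiableN.
  rewrite derive_fN// (coord0_derive X (derivable_q Iy)).
  rewrite mD_M; [|exact: dgr|exact: mdiff_cst].
  rewrite mD_cst mulmx0 addr0 mD_g_rsub//; congr (_ + _).
  by rewrite scaleNr.
- rewrite mD_D//; last first.
    by apply: mdiff_scalar; apply: differentiableM => //; exact: differentiable_cst.
  rewrite (mD_chain X (mdiff_rsub y) (conn_mdiff (rsubmx Y) (smg Dy))) mD_rsub.
  rewrite mD_scalar (derive_fM X (differentiable_cst _ _) dphi).
  by rewrite derive_cst mul0r add0r (coord0_derive X (derivable_phi Iy)).
Qed.

Lemma warped_curvature_conn X Y y : warped_domain y ->
  curvature (conn warped_metric) X Y y = curvature warped_conn X Y y.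
Proof.
move=> Vy; rewrite /curvature -(warped_connE X Vy) -(warped_connE Y Vy).
have E Z T : mD Z (conn warped_metric T) y = mD Z (warped_conn T) y.
  apply: near_mD; apply: filterS (open_near open_warped_domain Vy) => z Vz.
  by rewrite warped_connE.
by rewrite !E.
Qed.

Lemma warped_curvatureE X Y y : warped_domain y ->
  let t := y 0 0 in let z := rsubmx y in
  let x := rsubmx X in let v := rsubmx Y in
  let w := X 0 0 *: v - Y 0 0 *: x in
  curvature warped_conn X Y y =
  block_mx 0 ((f2 t / f t) *: w) (- (f t * f2 t) *: (g z *m w^T))
    (curvature (conn g) x v z - (f1 t ^+ 2) *: (g z *m (v^T *m x - x^T *m v))).
Proof.
move=> Vy t z x v w; have [Iy Dy] := Vy; have lc := conn_levi_civita (smg Dy).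
rewrite /curvature !mD_warped_conn//; apply: warped_curvature_algebra.
- exact: symg.
- exact: lc_metric lc _.
- exact: lc_metric lc _.
- exact: lc_torsion lc _ _.
- by rewrite derive_phi// subrK.
- rewrite derive_q// /phi /q -/t; have := fn0 Iy; rewrite -/t.
  by move: (f t) (f1 t) (f2 t) => c c1 c2 c0; field.
- rewrite /phi /q -/t; have := fn0 Iy; rewrite -/t.
  by move: (f t) (f1 t) => c c1 c0; field.
Qed.

Lemma warped_curvature_form X Y y : warped_domain y ->
  let t := y 0 0 in let z := rsubmx y in
  let x := rsubmx X in let v := rsubmx Y in
  let w := X 0 0 *: v - Y 0 0 *: x in
  (Y *m curvature (conn warped_metric) X Y y *m warped_metric y *m X^T) 0 0 =
  - (f t * f2 t) * inner (g z) w w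
  + f t ^+ 2 * (inner (g z) (v *m curvature (conn g) x v z) x
     - f1 t ^+ 2 * (inner (g z) x x * inner (g z) v v - inner (g z) x v ^+ 2)).
Proof.
move=> Vy t z x v w; rewrite warped_curvature_conn// warped_curvatureE//.
rewrite -/t -/z -/x -/v -/w; have [Iy Dy] := Vy.
set Om := curvature (conn g) x v z.
change (inner (warped_metric y) (Y *m block_mx 0 ((f2 t / f t) *: w)
  (- (f t * f2 t) *: (g z *m w^T))
  (Om - f1 t ^+ 2 *: (g z *m (v^T *m x - x^T *m v)))) X =
  - (f t * f2 t) * inner (g z) w w
  + f t ^+ 2 * (inner (g z) (v *m Om) x
     - f1 t ^+ 2 * (inner (g z) x x * inner (g z) v v - inner (g z) x v ^+ 2))).
rewrite warped_inner -{1 2}[Y]hsubmxK row0_scalar -/v mul_row_block row_mxKr.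
rewrite mulmx0 add0r -/t -/z -/x row_mx00.
have -> : (v *m (- (f t * f2 t) *: (g z *m w^T))) 0 0 =
    - (f t * f2 t) * inner (g z) v w.
  by rewrite -scalemxAr mxE mulmxA.
have -> : (Y 0 0)%:M *m (f2 t / f t *: w) +
    v *m (Om - f1 t ^+ 2 *: (g z *m (v^T *m x - x^T *m v))) =
    (Y 0 0 * (f2 t / f t)) *: w + v *m Om
    - f1 t ^+ 2 *: (inner (g z) v v *: x - inner (g z) v x *: v).
  rewrite mul_scalar_mx scalerA mulmxBr addrA -scalemxAr; congr (_ - _ *: _).
  rewrite mulmxA mulmxBr !mulmxA [v *m _ *m v^T]mx11_scalar [v *m _ *m x^T]mx11_scalar.
  by rewrite !mul_scalar_mx.
have sx : inner (g z) v x = inner (g z) x v by exact: inner_sym (symg Dy).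
(* Only one slot is expanded: [f''] appears with [a <v, w>] from the interval component and with
   [b <w, x>] from the fiber, and these recombine into [<w, w>]. *)
have sw : inner (g z) w w = X 0 0 * inner (g z) v w - Y 0 0 * inner (g z) w x.
  by rewrite {1}/w innerBl !innerZl (inner_sym w x (symg Dy)).
clearbody w.
rewrite innerBl innerDl !innerZl innerBl !innerZl.
rewrite sw sx; have := fn0 Iy; rewrite -/t.
generalize (inner (g z) v w) (inner (g z) w x) (inner (g z) x v) (inner (g z) v v)
  (inner (g z) x x) (inner (g z) (v *m Om) x).
move: (f t) (f1 t) (f2 t) => c c1 c2 A1 A2 A3 A4 A5 A6 c0.
by field.
Qed.

End Warped.

(** * From sectional curvature to the curvature form *)

Section SectionalBound.
Context {R : realType} {n : nat} (g : 'rV[R]_n -> 'M[R]_n) (z : 'rV[R]_n).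
Hypothesis sm : smooth_metric_at g z.
Hypothesis pg : posdef (g z).
Implicit Types (u v x : 'rV[R]_n).

Lemma curvature_self v : curvature (conn g) v v z = 0.
Proof. by rewrite /curvature subrr add0r subrr. Qed.

Lemma curvature_scale_self (c : R) v : curvature (conn g) (c *: v) v z = 0.
Proof.
have sg := nbhs_singleton (sm_sym sm).
rewrite (curvature_linear_l _ _ sm); under eq_bigr do rewrite mxE -scalerA.
by rewrite -scaler_sumr -(curvature_linear_l _ _ sm) curvature_self scaler0.
Qed.

(** The sectional bound is a quotient over independent pairs. For dependent pairs both sides vanish;
    otherwise the Gram determinant is positive and can be cleared. *)
Lemma curvature_le_sectional (K : R) x v :
  (forall v w, row_free (col_mx v w) -> sectional g z v w <= K) ->
  inner (g z) (v *m curvature (conn g) x v z) x <=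
  K * (inner (g z) x x * inner (g z) v v - inner (g z) x v ^+ 2).
Proof.
move=> sec; have sg := nbhs_singleton (sm_sym sm).
have inner0 w : inner (g z) 0 w = 0 by rewrite /inner !mul0mx mxE.
have [->|v0] := eqVneq v 0.
  by rewrite mul0mx (inner_sym x 0 sg) !inner0 mulr0 expr0n subrr mulr0.
have vv := pg v0; have vvn0 : inner (g z) v v != 0 by rewrite gt_eqF.
(* [u] is the part of [x] orthogonal to [v], so the Gram determinant becomes [|u|^2 |v|^2] and
   dependence means [u = 0]. *)
pose c := inner (g z) x v / inner (g z) v v.
pose u := x - c *: v; have xE : x = u + c *: v by rewrite subrK.
have uv : inner (g z) u v = 0 by rewrite innerBl innerZl divfK// subrr.
have [u0|u0] := eqVneq u 0.
  rewrite xE u0 add0r curvature_scale_self mulmx0 inner0 innerZl.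
  rewrite (inner_sym _ (c *: v) sg) innerZl le_eqVlt; apply/orP; left.
  by apply/eqP; ring.
have uu := pg u0.
have gram : inner (g z) x x * inner (g z) v v - inner (g z) x v ^+ 2 =
    inner (g z) u u * inner (g z) v v.
  have uxE : inner (g z) u u = inner (g z) x x - c * inner (g z) x v.
    rewrite {1}/u innerBl innerZl (inner_sym v u sg) uv mulr0 subr0.
    by rewrite (inner_sym x u sg) innerBl innerZl (inner_sym v x sg).
  rewrite uxE /c; move: vvn0.
  move: (inner _ v v) (inner _ x v) (inner _ x x) => p q r p0.
  by field.
have free : row_free (col_mx x v).
  apply: inj_row_free => r; rewrite -[r]hsubmxK mul_row_col.
  rewrite [lsubmx r]mx11_scalar [rsubmx r]mx11_scalar !mul_scalar_mx.
  set r1 := lsubmx r 0 0; set r2 := rsubmx r 0 0 => E.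
  have r10 : r1 = 0.
    have : inner (g z) (r1 *: x + r2 *: v) u = 0 by rewrite E inner0.
    rewrite innerDl !innerZl (inner_sym v u sg) uv mulr0 addr0 {1}xE.
    rewrite innerDl innerZl (inner_sym v u sg) uv mulr0 addr0 => /eqP.
    by rewrite mulf_eq0 (gt_eqF uu) orbF => /eqP.
  have r20 : r2 = 0.
    by move/eqP: E; rewrite r10 scale0r add0r scaler_eq0 (negPf v0) orbF => /eqP.
  by rewrite r10 r20 !raddf0 row_mx0.
have := sec x v free; rewrite /sectional curv_curvature// ler_pdivrMr//.
by rewrite gram mulr_gt0.
Qed.

End SectionalBound.

Section WarpedNonpos.
Context {R : realType} {n : nat} (I : set R) (D : set 'rV[R]_n).
Variables (f : R -> R) (g : 'rV[R]_n -> 'M[R]_n).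
Hypothesis oI : open I.
Hypothesis oD : open D.
Hypothesis sf : forall k t, I t -> derivable (derive1n k f) t 1.
Hypothesis f0 : forall t, I t -> 0 < f t.
Hypothesis sg : forall i j, smooth_on D (fun y => g y i j).
Hypothesis symg : forall y, D y -> (g y)^T = g y.
Hypothesis pg : forall y, D y -> posdef (g y).
Hypothesis f2_ge0 : forall t, I t -> 0 <= derive1 (derive1 f) t.
Hypothesis sec : forall t z, I t -> D z -> forall v w : 'rV[R]_n,
  row_free (col_mx v w) -> sectional g z v w <= derive1 f t ^+ 2.

Lemma warped_curvature_nonpos (X Y y : 'rV[R]_(1 + n)) : warped_domain I D y ->
  (Y *m curvature (conn (warped_metric f g)) X Y y *m warped_metric f g y
    *m X^T) 0 0 <= 0.
Proof.
move=> Vy; have [Iy Dy] := Vy.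
rewrite (warped_curvature_form oI oD sf f0 sg symg pg X Y Vy).
have H := curvature_le_sectional (smooth_metric oD sg symg pg Dy) (pg Dy)
  (rsubmx X) (rsubmx Y) (sec Iy Dy).
have H2 : 0 <= f (y 0 0) * derive1 (derive1 f) (y 0 0).
  by rewrite mulr_ge0 ?f2_ge0// ltW// f0.
rewrite -[leRHS]addr0 lerD//; first by rewrite mulNr oppr_le0 mulr_ge0//; exact/inner_ge0/pg.
by rewrite mulr_ge0_le0 ?sqr_ge0// subr_le0.
Qed.

End WarpedNonpos.

(** * Growth of the potential along geodesics *)

Section OneVariable.
Context {R : realType}.
Implicit Types (f y : R -> R).

Lemma mvt_derive1 f (a b : R) : a < b ->
  (forall t, a <= t <= b -> derivable f t 1) ->
  exists2 c, a < c < b & f b - f a = derive1 f c * (b - a).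
Proof.
move=> ab df; have [t||c + E] := @MVT R f (derive1 f) a b ab.
- rewrite in_itv/= => /andP[t1 t2]; rewrite derive1E; apply: derivableP.
  by apply: df; rewrite !ltW.
- by apply: derivable_within_continuous => s; rewrite in_itv/=; exact: df.
- by rewrite in_itv/=; exists c.
Qed.

Lemma midpoint_convex (D : set R) f (x z : R) :
  convex_function (D : set R^o) f -> D x -> D z ->
  f ((x + z) / 2) <= (f x + f z) / 2.
Proof.
move=> cf Dx Dz.
have h01 : (0 <= (2^-1 : R) <= 1) by rewrite invr_ge0 ler0n invf_le1 ?ler1n ?ltr0n.
have := cf (Itv01 (proj1 (andP h01)) (proj2 (andP h01))) x z (mem_set Dx) (mem_set Dz).
have h2 : 1 - 2^-1 = 2^-1 :> R by field.
have H : f (2^-1 * x + (1 - 2^-1) * z) <= 2^-1 * f x + (1 - 2^-1) * f z ->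
    f ((x + z) / 2) <= (f x + f z) / 2.
  by rewrite h2 ![2^-1 * _]mulrC -!mulrDl.
exact: H.
Qed.

(* If [y a > 0], then [1 / y + mu t] is nonincreasing on [t >= a], so that
   [1 / y] becomes nonpositive at [a + 1 / (mu y(a))]. *)
Lemma blowup_le0 (mu : R) y : 0 < mu -> (forall t, derivable y t 1) ->
  (forall t, mu * y t ^+ 2 <= derive1 y t) -> forall t, y t <= 0.
Proof.
move=> mu0 dy Hy a; rewrite leNgt; apply/negP => ya.
have mono b : a <= b -> y a <= y b.
  rewrite le_eqVlt => /orP[/eqP->//|ab].
  have [c _ E] := mvt_derive1 ab (fun t _ => dy t); rewrite -subr_ge0 E mulr_ge0//.
    by apply: le_trans (Hy c); rewrite mulr_ge0 ?sqr_ge0 ?ltW.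
  by rewrite subr_ge0 ltW.
pose b := a + (mu * y a)^-1.
have ab : a < b by rewrite ltrDl invr_gt0 mulr_gt0.
pose w t := (y t)^-1.
have yn0 t : a <= t -> y t != 0.
  by move=> /mono yat; rewrite gt_eqF// (lt_le_trans ya).
have [t /andP[ta tb]|c /andP[ac cb]] := @mvt_derive1 w a b ab.
  by apply: derivableV => //; exact: yn0.
have -> : derive1 w c = - (y c) ^- 2 * derive1 y c.
  by rewrite derive1E (deriveV (yn0 _ (ltW ac)) (dy c)) -derive1E.
have yc : 0 < y c by apply: lt_le_trans ya (mono _ (ltW ac)).
have -> : b - a = (mu * y a)^-1 by rewrite /b addrC addKr.
rewrite /w => E.
have yb : 0 < (y b)^-1 by rewrite invr_gt0; apply: lt_le_trans ya (mono _ (ltW ab)).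
have k : mu <= (y c) ^- 2 * derive1 y c.
  by rewrite ler_pdivlMl ?exprn_gt0// mulrC.
have : (y b)^-1 <= 0.
  rewrite -(subrK (y a)^-1 (y b)^-1) E mulNr.
  have : mu * (mu * y a)^-1 <= (y c) ^- 2 * derive1 y c * (mu * y a)^-1.
    by rewrite ler_wpM2r// invr_ge0 mulr_ge0// ltW.
  rewrite invfM mulVKf ?gt_eqF//; lra.
by rewrite leNgt yb.
Qed.

Lemma blowup_absurd (mu : R) y : 0 < mu -> (forall t, derivable y t 1) ->
  (forall t, mu * y t ^+ 2 <= derive1 y t) -> ~ 0 < derive1 y 0.
Proof.
move=> mu0 dy Hy; have yle := blowup_le0 mu0 dy Hy.
(* The inequality is invariant under this reflection, so [blowup_le0] bounds [y] from both sides and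
   forces [y = 0]. *)
pose z t := - y (- t).
have dN (t : R) : is_derive t 1 (fun s : R => - s) (-1 : R).
  by apply: is_deriveN.
have dz (t : R) : is_derive t 1 z (derive1 y (- t)).
  have dy' : is_derive (- t) 1 y (derive1 y (- t)).
    by rewrite derive1E; exact: derivableP.
  have := @is_derive1_comp R y (fun s => - s) t _ _ dy' (dN t).
  move=> /is_deriveN; rewrite mulrN1 opprK; exact.
have dz' t : derivable z t 1 by have [] := dz t.
have zle := blowup_le0 mu0 dz'.
have y0 t : y t = 0.
  apply/eqP; rewrite eq_le yle /=; have := zle _ (- t).
  rewrite /z opprK oppr_le0; apply => s.
  rewrite derive1E (@derive_val _ _ _ _ _ _ _ (dz s)).
  by rewrite sqrrN.
have -> : y = cst 0 by exact/funext.
by rewrite derive1_cst ltxx.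
Qed.

(** If [f''] were negative at [t], it would be so near [t] by continuity. Then [f'] would be smaller
    at a mean value point right of [t] than at one left of it, lifting [f t] above the midpoint of a
    chord. *)
Lemma convex_derive2_ge0 (I : set R) f t : open I ->
  (forall k t, I t -> derivable (derive1n k f) t 1) ->
  convex_function (I : set R^o) f -> I t -> 0 <= derive1 (derive1 f) t.
Proof.
have alg (k a p q : R) : k * (p - q) < 0 ->
    a <= (a - q * k + (a + p * k)) / 2 -> False by lra.
move=> oI sf cf It; rewrite leNgt; apply/negP => f2t.
have cf2 : {for t, continuous (derive1 (derive1 f))}.
  by apply/differentiable_continuous/derivable1_diffP; exact: (sf 2%N t It).
have Hn : \forall s \near t, derive1 (derive1 f) s < 0 /\ I s.
  apply: filterI; last exact: open_nbhs_nbhs.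
  exact: (cvgr_lt _ cf2).
have /nbhs_normP[r r0 Hr] := Hn.
have Ir s : `|t - s| < r -> derive1 (derive1 f) s < 0 /\ I s by move=> ?; exact: Hr.
(* Half the radius keeps the closed interval [[t - h, t + h]] inside the open ball. *)
pose h := r / 2; have h0 : 0 < h by rewrite divr_gt0.
have hr : h < r by rewrite /h; move: r0 => /= r0; lra.
have near_t s : t - h <= s <= t + h -> `|t - s| < r.
  by move=> /andP[s1 s2]; rewrite ltr_norml; apply/andP; split; lra.
have df k s : t - h <= s <= t + h -> derivable (derive1n k f) s 1.
  by move=> /near_t/Ir[_ Is]; exact: sf.
have [|s sI|c1 /andP[c1l c1r] E1] := @mvt_derive1 f t (t + h); first by lra.
  by apply: (df 0%N); lra.
have [|s sI|c2 /andP[c2l c2r] E2] := @mvt_derive1 f (t - h) t; first by lra.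
  by apply: (df 0%N); lra.
have [|s sI|c /andP[cl cr] E3] := @mvt_derive1 (derive1 f) c2 c1; first by lra.
  by apply: (df 1%N); lra.
have cI : t - h <= c <= t + h.
  by rewrite (ltW (lt_trans c2l cl)) (ltW (lt_trans cr c1r)).
have [fc _] := Ir _ (near_t c cI).
have I1 : I (t - h).
  by apply: (Ir _ (near_t _ _)).2; rewrite lexx/= lerBlDr -addrA lerDl addr_ge0// ltW.
have I2 : I (t + h).
  by apply: (Ir _ (near_t _ _)).2; rewrite lexx andbT lerBlDr -addrA lerDl addr_ge0// ltW.
have := midpoint_convex cf I1 I2.
have -> : (t - h + (t + h)) / 2 = t by field.
have neg : derive1 (derive1 f) c * (c1 - c2) < 0.
  by rewrite nmulr_rlt0// subr_gt0 (lt_trans c2r).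
have neg2 : h * (derive1 f c1 - derive1 f c2) < 0 by rewrite E3 pmulr_rlt0.
have -> : f (t + h) = f t + derive1 f c1 * h by rewrite -[f (t + h)](subrK (f t)) E1; ring.
have -> : f (t - h) = f t - derive1 f c2 * h.
  by rewrite -[f t](subrK (f (t - h))) E2; ring.
exact: alg neg2.
Qed.

End OneVariable.

(** * Second derivative of a function along a geodesic *)

Section Geodesic.
Context {R : realType} {n : nat} (U : set 'rV[R]_n) (oU : open U).
Variables (g : 'rV[R]_n -> 'M[R]_n) (h : 'rV[R]_n -> R) (x : R -> 'rV[R]_n).
Hypothesis sh : smooth_on U h.

Let xc (k : 'I_n) (t : R) := x t 0 k.

Lemma curve_mdiff t : (forall k, derivable (xc k) t 1) -> mdiff x t.
Proof. by move=> dx i k; rewrite ord1; apply/derivable1_diffP; exact: dx. Qed.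

Lemma curve_chain (H : 'rV[R]_n -> R) t : differentiable H (x t) ->
  (forall k, derivable (xc k) t 1) ->
  'D_1 (fun s => H (x s)) t = \sum_k derive1 (xc k) t * partial k H (x t).
Proof.
move=> dH dx; rewrite (derive_chain _ (curve_mdiff dx) dH) derive_row//.
by apply: eq_bigr => k _; rewrite mDij derive1E.
Qed.

Lemma curve_second_derivative t :
  (\forall s \near t, U (x s) /\ forall k, derivable (xc k) s 1) ->
  (forall k, derivable (derive1 (xc k)) t 1) ->
  derivable (derive1 (fun s => h (x s))) t 1 /\
  derive1 (derive1 (fun s => h (x s))) t =
    \sum_k (derive1 (derive1 (xc k)) t * partial k h (x t)
      + derive1 (xc k) t *
        \sum_l derive1 (xc l) t * partial l (partial k h) (x t)).
Proof.
move=> Hn ddx; have [Ux dx] := nbhs_singleton Hn.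
have near1 : \forall s \near t, \sum_k derive1 (xc k) s * partial k h (x s) =
    derive1 (fun s => h (x s)) s.
  apply: filterS Hn => s [Us ds].
  by rewrite derive1E curve_chain//; exact: smooth_differentiable Us.
have dp k : differentiable (partial k h) (x t).
  exact: smooth_differentiable (smooth_partial k sh) Ux.
have dpx k : differentiable (fun s => partial k h (x s)) t.
  exact: (differentiable_chain (curve_mdiff dx) (dp k)).
have ddx' k : differentiable (derive1 (xc k)) t by exact/derivable1_diffP.
split.
  apply/derivable1_diffP; apply: near_differentiable near1 _.
  by apply: differentiable_fsum => k; apply: differentiableM.
rewrite derive1E -(near_eq_derive _ near1) derive_fsum => [|k]; last first.
  exact: differentiableM.
apply: eq_bigr => k _; rewrite (derive_fM _ (ddx' k) (dpx k)) -derive1E.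
by rewrite curve_chain.
Qed.

(** The geodesic equation trades the second derivatives of the coordinates for the Christoffel terms
    of the Hessian. *)
Lemma geodesic_hessian t :
  (\forall s \near t, U (x s) /\ forall k, derivable (xc k) s 1) ->
  (forall k, derivable (derive1 (xc k)) t 1) ->
  (forall k, derive1 (derive1 (xc k)) t + \sum_i \sum_j
    christoffel g k i j (x t) * derive1 (xc i) t * derive1 (xc j) t = 0) ->
  derive1 (derive1 (fun s => h (x s))) t =
  \sum_i \sum_j derive1 (xc i) t * derive1 (xc j) t * hess g h i j (x t).
Proof.
move=> Hn ddx geo; have [_ ->] := curve_second_derivative Hn ddx.
pose v i := derive1 (xc i) t.
have E k : derive1 (derive1 (xc k)) t =
    - \sum_i \sum_j christoffel g k i j (x t) * v i * v j.
  by apply/eqP; rewrite -addr_eq0; apply/eqP; exact: geo.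
rewrite big_split /=.
transitivity (\sum_i \sum_j (v i * v j * partial i (partial j h) (x t)
    - \sum_k v i * v j * (christoffel g k i j (x t) * partial k h (x t)))).
  under [RHS]eq_bigr do rewrite sumrB.
  rewrite sumrB addrC; congr (_ + _).
    rewrite exchange_big; apply: eq_bigr => i _.
    by rewrite mulr_sumr; apply: eq_bigr => j _; rewrite mulrCA mulrA.
  under [X in - X]eq_bigr do rewrite exchange_big.
  rewrite exchange_big -sumrN; apply: eq_bigr => k _; rewrite E mulNr; congr (- _).
  rewrite mulr_suml; apply: eq_bigr => i _; rewrite mulr_suml.
  have alg (p q r s : R) : p * q * r * s = q * r * (p * s) by ring.
  by apply: eq_bigr => j _; rewrite alg.
apply: eq_bigr => i _; apply: eq_bigr => j _.
by rewrite /hess mulrBr mulr_sumr.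
Qed.

End Geodesic.

(** * Manifolds *)

Section Charts.
Context {R : realType} {n : nat} (X : geometry R n).

(** Openness is postulated for full chart images only; continuity of [param] gives it for the trace
    of any open set. *)
Lemma open_chart_image (c : chart X) (A : set X) : smooth_manifold X -> open A ->
  open (coord c @` (dom c `&` A)).
Proof.
move=> sX oA; rewrite openE => _ [q [cq Aq] <-].
have Iq : (coord c @` dom c) (coord c q) by exists q.
have cont := mfd_param_continuous sX Iq.
have nA : \forall x \near coord c q, A (param c x).
  by apply: cont; rewrite (mfd_coordK sX cq); apply: open_nbhs_nbhs.
have nI : \forall x \near coord c q, (coord c @` dom c) x.
  by apply: open_nbhs_nbhs; split => //; exact: mfd_image_open.
rewrite /interior; apply: filterS2 nA nI => x Ax [q' cq' xE].
by exists q' => //; split => //; rewrite -(mfd_coordK sX cq') xE.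
Qed.

Lemma chart_smooth_metric (c : chart X) x : riemannian_manifold X ->
  (coord c @` dom c) x -> smooth_metric_at (metric c) x.
Proof.
move=> rX Ux; have sX := riem_manifold rX.
apply: (smooth_metric _ _ _ _ Ux).
- exact: mfd_image_open.
- by move=> i j; exact: riem_smooth.
- by move=> y; exact: riem_sym.
- by move=> y Uy v; exact: riem_posdef.
Qed.

Lemma riem_inner_ge0 (c : chart X) q v : riemannian_manifold X -> dom c q ->
  0 <= inner (metric c (coord c q)) v v.
Proof.
by move=> rX cq; apply: inner_ge0 => w; apply: (riem_posdef rX); exists q.
Qed.

End Charts.

Section MinimalImmersion.
Context {R : realType} {n : nat} (Sigma M : geometry R n).
Variables (I : open_interval R) (f : R -> R).
Variable phi : Sigma -> warped_product I f M.
Hypothesis hn : (0 < n)%N.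
Hypothesis HS : riemannian_manifold Sigma.
Hypothesis HM : riemannian_manifold M.
Hypothesis f_smooth : smooth_on_interval I f.
Hypothesis f_pos : forall t, oi_set I t -> 0 < f t.
Hypothesis f_convex : convex_function (oi_set I : set R^o) f.
Hypothesis HkM : forall t, oi_set I t -> sectional_le M (derive1 f t ^+ 2).
Hypothesis Hphi : isometric_immersion phi.
Hypothesis Hmin : minimal phi.

(** Localizes [ricci_nonpos]: a chart of [M] is also a chart of the warped product, and there the
    metric is [warped_metric f (metric d)] by construction. *)
Lemma minimal_ricci_nonpos (c : chart Sigma) q (v : 'rV[R]_n) : dom c q ->
  \sum_j \sum_k v 0 j * v 0 k * ricci (metric c) j k (coord c q) <= 0.
Proof.
move=> cq; have sS := riem_manifold HS; have sM := riem_manifold HM.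
have [d dq] := mfd_cover sM (phi q : I * M).2.
pose d' : chart (warped_product I f M) := d.
pose A : set Sigma := phi @^-1` dom d'.
have oA : open A.
  apply: open_comp => [p _|]; first exact: (iso_smooth Hphi).1.
  have -> : dom d' = (@snd I M) @^-1` dom d by [].
  apply: open_comp => [p _|]; first exact: cvg_snd.
  exact: mfd_dom_open.
(* The part of the chart [c] that [phi] sends into [d'], where the coordinate expression of [phi] is
   smooth. *)
pose U := coord c @` (dom c `&` A).
have oU : open U by exact: open_chart_image.
have Uq : U (coord c q) by exists q.
pose F := local_map phi c d'.
pose V := warped_domain I (coord d @` dom d).
have FV x : U x -> V (F x).
  move=> [q' [cq' Aq'] <-]; rewrite /F /local_map (mfd_coordK sS cq').
  split => /=.
    rewrite row_mx00 mxE; exact: set_valP.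
  by rewrite row_mxKr; exists (phi q' : I * M).2.
have oI : open (oi_set I) by exact: oi_open.
have oD : open (coord d @` dom d) by exact: mfd_image_open.
have sg i j : smooth_on (coord d @` dom d) (fun y => metric d y i j).
  exact: riem_smooth.
have symg y : (coord d @` dom d) y -> (metric d y)^T = metric d y.
  exact: riem_sym.
have pg y : (coord d @` dom d) y -> posdef (metric d y).
  by move=> Dy w; exact: riem_posdef.
have smG x : U x -> smooth_metric_at (warped_metric f (metric d)) (F x).
  by move=> /FV; apply: warped_smooth_metric.
have smg x : U x -> smooth_metric_at (metric c) x.
  by move=> [q' [cq' _] <-]; apply: chart_smooth_metric => //; exists q'.
have sF a : smooth_on U (Defs.comp F a) := (iso_smooth Hphi).2 c d' a.
have gF x : U x -> metric c x = pullback F (warped_metric f (metric d)) x.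
  by move=> [q' [cq' Aq'] <-]; rewrite -(iso_metric Hphi cq' (Aq' : dom d' _)).
have pgq : posdef (metric c (coord c q)).
  by move=> w; apply: (riem_posdef HS); exists q.
have pGq : posdef (warped_metric f (metric d) (F (coord c q))).
  by apply: (warped_metric_posdef f_pos pg); exact: FV.
apply: (ricci_nonpos oU sF smg smG gF) => //.
  apply: (minimal_tension0 oU sF smg smG gF) => // nu.
  exact: (Hmin cq (dq : dom d' (phi q))).
move=> X Y; apply: (warped_curvature_nonpos oI oD f_smooth f_pos sg symg pg).
- by move=> t It; exact: (convex_derive2_ge0 oI f_smooth f_convex It).
- by move=> t z It [q' dq' <-] a b fr; exact: HkM fr.
- exact: FV.
Qed.

End MinimalImmersion.

(** * The Hessian inequality and the contradiction *)

Section HessianGrowth.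
Context {R : realType} {n p : nat} (Sigma : geometry R n) (N : geometry R p).
Variables (alpha mu : R) (h lambda : Sigma -> R) (u : Sigma -> N).
Hypothesis Hgrad : gradient_einstein_type alpha h u (fun _ => mu) lambda.
Hypothesis ric : forall (c : chart Sigma) q (v : 'rV[R]_n), dom c q ->
  \sum_j \sum_k v 0 j * v 0 k * ricci (metric c) j k (coord c q) <= 0.

(** The equation solved for [Hess h] leaves [- Ric] and [alpha u^*g'] besides the two terms kept;
    both are nonnegative, the second as a pullback of a positive form. *)
Lemma hessian_lower_bound (c : chart Sigma) q (v : 'rV[R]_n) : dom c q ->
  lambda q * inner (metric c (coord c q)) v v
    + mu * (\sum_k v 0 k * partial k (local_fun h c) (coord c q)) ^+ 2 <=
  \sum_i \sum_j v 0 i * v 0 j * hess (metric c) (local_fun h c) i j (coord c q).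
Proof.
move=> cq; have [d dq] := mfd_cover (riem_manifold (get_target Hgrad)) (u q).
set x := coord c q; set g := metric c; set hc := local_fun h c.
set P := pullback (local_map u c d) (metric d) x.
have E i j : hess g hc i j x = lambda q * g x i j - ricci g i j x + alpha * P i j
    + mu * (partial i hc x * partial j hc x).
  by rewrite -(get_einstein Hgrad cq dq i j) -/x -/g -/hc -/P; ring.
have formE (A : 'M[R]_n) : inner A v v = \sum_i \sum_j v 0 i * v 0 j * A i j.
  rewrite /inner mxE exchange_big; apply: eq_bigr => j _ /=.
  rewrite !mxE mulr_suml; apply: eq_bigr => i _.
  by rewrite mulrAC.
have P0 : 0 <= inner P v v.
  have -> : inner P v v = inner (metric d (coord d (u q)))
      (v *m dmap (local_map u c d) x) (v *m dmap (local_map u c d) x).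
    have -> : coord d (u q) = local_map u c d x.
      by rewrite /local_map (mfd_coordK (riem_manifold (get_riemannian Hgrad)) cq).
    by rewrite /inner /P /pullback trmx_mul !mulmxA.
  exact: riem_inner_ge0 (get_target Hgrad) dq.
have sq : (\sum_k v 0 k * partial k hc x) ^+ 2 =
    \sum_i \sum_j v 0 i * v 0 j * (partial i hc x * partial j hc x).
  rewrite expr2 mulr_suml; apply: eq_bigr => i _.
  by rewrite mulr_sumr; apply: eq_bigr => j _; rewrite mulrACA.
have -> : \sum_i \sum_j v 0 i * v 0 j * hess g hc i j x =
    lambda q * inner (g x) v v - \sum_j \sum_k v 0 j * v 0 k * ricci g j k x
    + alpha * inner P v v + mu * (\sum_k v 0 k * partial k hc x) ^+ 2.
  rewrite sq !formE !mulr_sumr -sumrB -!big_split /=; apply: eq_bigr => i _.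
  rewrite !mulr_sumr -sumrB -!big_split /=; apply: eq_bigr => j _.
  by rewrite E; ring.
have := ric v cq; rewrite -/x -/g => R0.
rewrite lerD2r -addrA lerDl addr_ge0 ?oppr_ge0// mulr_ge0// ltW//.
exact: get_alpha Hgrad.
Qed.

(** [y] is defined without charts, so the inequalities obtained in different charts along [gamma]
    concern one function on the whole line. *)
Lemma potential_growth (gamma : R -> Sigma) (c : chart Sigma) t :
  geodesic gamma -> dom c (gamma t) ->
  let y := derive1 (fun s => h (gamma s)) in
  let v := \row_k derive1 (curve_coord gamma c k) t in
  derivable y t 1 /\
  lambda (gamma t) * inner (metric c (coord c (gamma t))) v v + mu * y t ^+ 2
    <= derive1 y t.
Proof.
move=> [cgamma geo] ct y v.
have sS := riem_manifold (get_riemannian Hgrad).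
pose O := gamma @^-1` dom c.
have oO : open O by apply: open_comp => [s _|]; [exact: cgamma|exact: mfd_dom_open].
pose x s := coord c (gamma s); pose hc := local_fun h c.
have hE s : O s -> h (gamma s) = hc (x s).
  by move=> Os; rewrite /hc /local_fun (mfd_coordK sS Os).
have nO s : O s -> \forall s' \near s, O s' by move=> Os; apply: open_nbhs_nbhs.
have yE s : O s -> y s = derive1 (fun s => hc (x s)) s.
  move=> Os; rewrite /y !derive1E; apply: near_eq_derive.
  by apply: filterS (nO _ Os) => s' /hE.
have nyE : \forall s \near t, derive1 (fun s => hc (x s)) s = y s.
  by apply: filterS (nO _ ct) => s /yE.
have oU : open (coord c @` dom c) by exact: mfd_image_open.
have sh : smooth_on (coord c @` dom c) hc := get_h_smooth Hgrad c.
have Hn : \forall s \near t, (coord c @` dom c) (x s) /\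
    forall k, derivable (fun s => x s 0 k) s 1.
  apply: filterS (nO _ ct) => s Os; split; first by exists (gamma s).
  by move=> k; have [] := geo c s Os k.
have ddx k : derivable (derive1 (fun s => x s 0 k)) t 1.
  by have [] := geo c t ct k.
have geoE k : derive1 (derive1 (fun s => x s 0 k)) t + \sum_i \sum_j
    christoffel (metric c) k i j (x t) * derive1 (fun s => x s 0 i) t *
      derive1 (fun s => x s 0 j) t = 0.
  by have [] := geo c t ct k.
have [dy _] := curve_second_derivative oU sh Hn ddx.
split; first exact: near_eq_derivable nyE dy.
have -> : derive1 y t = \sum_i \sum_j v 0 i * v 0 j * hess (metric c) hc i j (x t).
  transitivity (derive1 (derive1 (fun s => hc (x s))) t).
    rewrite derive1E [RHS]derive1E; apply: near_eq_derive.
    by apply: filterS nyE => s ->.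
  rewrite (geodesic_hessian oU sh Hn ddx geoE).
  by apply: eq_bigr => i _; apply: eq_bigr => j _; rewrite !mxE.
have -> : y t = \sum_k v 0 k * partial k hc (x t).
  have [Ut dx] := nbhs_singleton Hn.
  rewrite yE// derive1E (curve_chain (smooth_differentiable oU sh Ut) dx).
  by apply: eq_bigr => k _; rewrite mxE.
exact: hessian_lower_bound.
Qed.

Lemma potential_growth_absurd : (0 < n)%N -> 0 < mu -> (forall q, 0 < lambda q) ->
  False.
Proof.
move=> hn mu0 lambda0; have rS := get_riemannian Hgrad.
have cov := mfd_cover (riem_manifold rS).
have [[q _] _] := get_connected Hgrad; have [c cq] := cov q.
(* An arbitrary nonzero initial velocity; it is nonzero because [n > 0]. *)
pose v : 'rV[R]_n := const_mx 1.
have [gamma [geo g0 gv]] := get_complete Hgrad v cq.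
pose y := derive1 (fun s => h (gamma s)).
have dy t : derivable y t 1.
  by have [d dt] := cov (gamma t); have [] := potential_growth geo dt.
apply: (@blowup_absurd _ mu y) => // [t|].
  have [d dt] := cov (gamma t); have [_] := potential_growth geo dt.
  apply: le_trans; rewrite -/y lerDr mulr_ge0 ?(ltW (lambda0 _))//.
  exact: riem_inner_ge0.
have c0 : dom c (gamma 0) by rewrite g0.
have [_] := potential_growth geo c0; apply: lt_le_trans.
have -> : \row_k derive1 (curve_coord gamma c k) 0 = v.
  by apply/rowP => k; rewrite !mxE gv mxE.
apply: ltr_wpDr; first by rewrite mulr_ge0 ?sqr_ge0 ?(ltW mu0).
apply: mulr_gt0 => //; apply: (riem_posdef rS); first by exists (gamma 0).
apply/eqP => /rowP/(_ (Ordinal hn)); rewrite !mxE => /eqP.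
by rewrite oner_eq0.
Qed.

End HessianGrowth.

Theorem theorem4p7 (R : realType) (n p : nat) (hn : (0 < n)%N)
    (Sigma : geometry R n) (N : geometry R p) (M : geometry R n)
    (I : open_interval R) (f : R -> R)
    (alpha mu : R) (h lambda : Sigma -> R) (u : Sigma -> N)
    (phi : Sigma -> warped_product I f M)
    (HM : riemannian_manifold M)
    (HMconn : connected_manifold M)
    (HMor : oriented M)
    (f_smooth : smooth_on_interval I f)
    (f_pos : forall t, oi_set I t -> 0 < f t)
    (Hgrad : gradient_einstein_type alpha h u (fun _ => mu) lambda)
    (Hphi : isometric_immersion phi)
    (Hh : forall q, h q = proj_interval (phi q))
    (mu_pos : 0 < mu)
    (f_convex : convex_function (oi_set I : set R^o) f)
    (lambda_pos : forall q, 0 < lambda q)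
    (HkM : forall t, oi_set I t -> sectional_le M (derive1 f t ^+ 2)) :
  ~ minimal phi.
Proof.
move=> Hmin; apply: (potential_growth_absurd Hgrad) => // c q v cq.
exact: (minimal_ricci_nonpos hn (get_riemannian Hgrad) HM f_smooth f_pos f_convex
  HkM Hphi Hmin).
Qed.
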